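(* There exist six pairwise non-isomorphic connected cubic graphs on $22$ vertices agreeing on order, size, girth, diameter, radius, vertex connectivity, edge connectivity, automorphism-group order, chromatic number, chromatic index, domination number, independence number, matching number, clique number, circumference, minimum orientable genus, and adjacency spectrum (hence also Laplacian spectrum and number of spanning trees) but whose orientable genus polynomials are pairwise distinct.
   Context: All graphs are finite and simple; cubic means $3$-regular. The circumference is the length of a longest cycle. A dart of $G$ is an ordered pair $(u,v)$ with $uv\in E(G)$. A rotation system $\rho$ of $G$ assigns to each vertex $v$ a cyclic ordering of its neighbours; $\sigma_v(u)$ denotes the neighbour of $v$ following $u$. The face permutation on darts is $\phi_\rho(u,v)=(v,\sigma_v(u))$; its cycles are the faces of $\rho$, and $F(\rho)$ is their number. For a connected cubic graph on $n$ vertices the genus of $\rho$ is given by Euler's formula, $g(\rho)=1+\frac n4-\frac12F(\rho)$. The orientable genus polynomial is $\Gamma_G(x)=\sum_\rho x^{g(\rho)}$ over all $2^n$ rotation systems; the minimum orientable genus is $\min_\rho g(\rho)$. *)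

(* Defs.v *)
From mathcomp Require Import all_boot all_order all_fingroup all_algebra all_field.

Set Implicit Arguments.
Unset Strict Implicit.
Unset Printing Implicit Defensive.

Import Order.TTheory GRing.Theory Num.Theory.

Record sgraph := SGraph {
  vertex :> finType;
  adj : rel vertex;
  adj_sym : symmetric adj;
  adj_irrefl : irreflexive adj
}.

Section Relations.
Variables (T : finType) (r : rel T).

Definition connected_in (A : {set T}) : bool :=
  [forall x in A, forall y in A,
     connect (fun u v => [&& u \in A, v \in A & r u v]) x y].

Definition has_cycle (k : nat) : bool :=
  (2 < k) && [exists c : k.-tuple T, ucycleb r c].

Definition colourable (k : nat) : bool :=
  [exists f : {ffun T -> 'I_k}, forall x, forall y, r x y ==> (f x != f y)].

(* The search bound is harmless: giving distinct colours to all points always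
   succeeds with #|T| colours. *)
Definition chromatic_rel : nat := find colourable (iota 0 #|T|.+1).

End Relations.

Section Invariants.
Variable G : sgraph.

Definition nbh (v : G) : {set G} := [set u | adj v u].

Definition cubic : Prop := forall v : G, #|nbh v| = 3.

Definition is_connected : bool := connected_in (@adj G) [set: G].

Definition darts : {set G * G} := [set d | adj d.1 d.2].

Definition edges : {set {set G}} := [set [set d.1; d.2] | d in darts].

Definition graph_order : nat := #|G|.

Definition graph_size : nat := #|edges|.

(* Minima are written [\big[minn/d]_(...)] or [find _ (iota 0 d)], where the
   default [d] is an upper bound for the values that can occur; it is returned
   as such only when no value exists (acyclic graph, unreachable vertex). *)
Definition girth : nat := find (has_cycle (@adj G)) (iota 0 #|G|.+1).

Definition circumference : nat :=
  \max_(k < #|G|.+1 | has_cycle (@adj G) k) k.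

Definition dist (x y : G) : nat :=
  find (fun k => [exists p : k.-tuple G, path (@adj G) x p && (last x p == y)])
       (iota 0 #|G|).

Definition eccentricity (x : G) : nat := \max_(y : G) dist x y.

Definition diameter : nat := \max_(x : G) eccentricity x.

Definition radius : nat := \big[minn/#|G|]_(x : G) eccentricity x.

(* Removing a vertex set counts as a cut if it leaves a disconnected graph or
   at most one vertex, so that complete graphs K_n get the value n - 1. *)
Definition vertex_connectivity : nat :=
  \big[minn/#|G|]_(S : {set G} |
     ~~ connected_in (@adj G) (~: S) || (#|~: S| <= 1)) #|S|.

Definition span_rel (F : {set {set G}}) : rel G :=
  fun x y => [set x; y] \in F.

Definition edge_connectivity : nat :=
  \big[minn/#|edges|]_(F : {set {set G}} |
     (F \subset edges) && ~~ connected_in (span_rel (edges :\: F)) [set: G])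
    #|F|.

Definition spanning_tree (F : {set {set G}}) : bool :=
  [&& F \subset edges,
      connected_in (span_rel F) [set: G] &
      [forall k : 'I_#|G|.+1, ~~ has_cycle (span_rel F) k]].

Definition spanning_tree_count : nat :=
  #|[set F : {set {set G}} | spanning_tree F]|.

Definition automorphisms : {set {perm G}} :=
  [set s : {perm G} | [forall x, forall y, adj (s x) (s y) == adj x y]].

Definition aut_order : nat := #|automorphisms|.

Definition chromatic_number : nat := chromatic_rel (@adj G).

Definition chromatic_index : nat :=
  chromatic_rel (fun e f : {e : {set G} | e \in edges} =>
                   (e != f) && (val e :&: val f != set0)).

Definition domination_number : nat :=
  \big[minn/#|G|]_(D : {set G} |
     [forall v, (v \in D) || [exists u in D, adj v u]]) #|D|.

Definition independence_number : nat :=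
  \max_(S : {set G} | [forall x in S, forall y in S, ~~ adj x y]) #|S|.

Definition matching_number : nat :=
  \max_(M : {set {set G}} | (M \subset edges) && trivIset M) #|M|.

Definition clique_number : nat :=
  \max_(K : {set G} | [forall x in K, forall y in K, (x != y) ==> adj x y]) #|K|.

Local Open Scope ring_scope.

Definition adjacency_mx : 'M[algC]_#|G| :=
  \matrix_(i, j) (adj (enum_val i) (enum_val j))%:R.

Definition laplacian_mx : 'M[algC]_#|G| :=
  diag_mx (\row_i #|nbh (enum_val i)|%:R) - adjacency_mx.

(* Eigenvalues listed with algebraic multiplicity, in no particular order:
   spectra are to be compared with [perm_eq]. *)
Definition spectrum n (M : 'M[algC]_n) : seq algC :=
  sval (closed_field_poly_normal (char_poly M)).

(* A cyclic ordering of the neighbours of v is encoded by its successor map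
   sigma_v, i.e. a permutation that fixes every non-neighbour of v and permutes
   the neighbours of v in a single cycle. *)
Definition rotation_system (rho : {ffun G -> {perm G}}) : bool :=
  [forall v, perm_on (nbh v) (rho v) &&
     [forall u in nbh v, porbit (rho v) u == nbh v]].

Definition face_map (rho : {ffun G -> {perm G}}) (d : G * G) : G * G :=
  (d.2, rho d.2 d.1).

(* face_map rho is a permutation of all pairs; for a rotation system it
   preserves the darts, and fcard counts its cycles among them. *)
Definition face_count (rho : {ffun G -> {perm G}}) : nat :=
  fcard (face_map rho) darts.

Definition euler_genus_formula (rho : {ffun G -> {perm G}}) : rat :=
  1 + #|G|%:R / 4 - (face_count rho)%:R / 2.

(* For a rotation system of a connected cubic graph the formula already gives
   a natural number, so the truncation is only a cast from rat to nat. *)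
Definition genus (rho : {ffun G -> {perm G}}) : nat :=
  Num.truncn (euler_genus_formula rho).

Definition genus_poly : {poly int} :=
  \sum_(rho : {ffun G -> {perm G}} | rotation_system rho) 'X^(genus rho).

Definition min_genus : nat :=
  \big[minn/#|G|]_(rho : {ffun G -> {perm G}} | rotation_system rho) genus rho.

End Invariants.

Definition isomorphic (G H : sgraph) : Prop :=
  exists f : G -> H, bijective f /\ (forall x y, adj (f x) (f y) = adj x y).

(* Main.v *)
From Stdlib Require Import BinNat Nnat.
Require Import Defs.
From mathcomp Require Import all_boot all_order all_fingroup all_algebra all_field.
From mathcomp Require Import lra.

(** Why the theorem holds.  The witnesses are explicit: six Hamiltonian cubic
    graphs on 22 vertices.  All six have girth 3, diameter 5, radius 4, vertex
    and edge connectivity 3, two automorphisms, chromatic number and index 3,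
    domination number 6, independence number 10, matching number 11, clique
    number 3, circumference 22, minimum genus 2 and 20923360 spanning trees.
    What has to be explained is why each of these values can be certified by a
    feasible computation.

    Genus.  A rotation system of a cubic graph is a choice of one of two turns
    at each vertex, so there are 2^22 of them.  The face map reverses a dart and
    then turns at its new tail.  Choosing the turn at one vertex after the other,
    the darts at a processed vertex can be short-circuited, which changes the
    number of cycles only by the cycles closed on the way
    ([porbits_cycle_count], [eliminateP]).  What remains is a permutation of the
    darts that leave unprocessed vertices, and equal permutations are merged, so
    a few hundred states suffice ([face_distributionP], [sum_face_count]).  The
    coefficient of x^6, counting the embeddings with a single face, already
    separates the six polynomials ([genus_poly_inj]).

    Spectra.  A nonsingular matrix P with P A = A' P forces equal characteristic
    polynomials ([char_poly_intertwined]).  Consecutive graphs of the list are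
    intertwined by 0/1 matrices, whose determinants are nonzero because they are
    nonzero modulo 5 ([intertwined_spectra]).  The graphs being regular, the
    same matrices serve for the Laplacians.

    Spanning trees are counted by deletion and contraction of the edges in turn.
    A partial choice of edges matters only through the partition which it
    induces on the vertices that still have undecided edges, and again equal
    states are merged ([acyclic_add], [tree_countP]).

    Isomorphisms.  A backtracking search lists all adjacency-preserving maps
    between two of the graphs: none between distinct ones, two from each graph
    to itself ([not_isomorphic], [aut_order_iso_maps]).

    The other invariants have short certificates on both sides: a triangle, a
    Hamiltonian cycle, a perfect matching, colourings, closures of neighbourhoods
    after deleting two vertices or two edges, counting for domination (a vertex
    dominates four vertices, and 4 * 5 < 22), and for independence a partition
    of the vertices into a triangle, a pentagon and seven edges. *)

Set Implicit Arguments.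
Unset Strict Implicit.
Unset Printing Implicit Defensive.

(** * Graphs given by lists of neighbours *)

Section ListGraph.
Variables (m : nat) (nb : seq (seq nat)).
Let n := m.+1.

Definition link (i j : nat) : bool :=
  [&& i != j, j \in nth [::] nb i & i \in nth [::] nb j].

Lemma link_sym : symmetric link.
Proof. by move=> i j; rewrite /link eq_sym [X in _ && X]andbC. Qed.

Lemma link_irrefl : irreflexive link.
Proof. by move=> i; rewrite /link eqxx. Qed.

(** Adjacency is symmetrised, so that any list of lists whatsoever yields a
    graph and no proof is stored in the data. *)
Definition lgraph : sgraph :=
  @SGraph 'I_n (fun u v => link u v) (fun u v => link_sym u v)
    (fun u => link_irrefl u).

Definition cubic_lists : bool :=
  (size nb == n) && all (fun i => let l := nth [::] nb i in
    [&& size l == 3, uniq l &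
        all (fun j => [&& j < n, i != j & i \in nth [::] nb j]) l]) (iota 0 n).

Hypothesis cub : cubic_lists.

Lemma cubicP i : i < n ->
  [/\ size (nth [::] nb i) = 3, uniq (nth [::] nb i) &
      forall j, j \in nth [::] nb i ->
        [/\ j < n, i != j & i \in nth [::] nb j]].
Proof.
move=> ltin; case/andP: cub => _ /allP/(_ i); rewrite mem_iota => /(_ ltin) /and3P[/eqP sz un /allP H].
by split=> // j /H /and3P[].
Qed.

Lemma nb_uniq i : uniq (nth [::] nb i).
Proof.
case: (ltnP i n) => [/cubicP[]//|lt]; case/andP: cub => /eqP sz _.
by rewrite nth_default // sz.
Qed.

Lemma linkE i j : i < n -> link i j = (j \in nth [::] nb i).
Proof.
move=> /cubicP[_ _ H]; rewrite /link; apply/and3P/idP => [[]//|jin].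
by have [_ ? ?] := H _ jin; split.
Qed.

Lemma adjE (u v : lgraph) : adj u v = ((v : nat) \in nth [::] nb u).
Proof. by rewrite -linkE. Qed.

Lemma nbh_perm (u : lgraph) :
  perm_eq [seq val v | v <- enum (nbh u)] (nth [::] nb u).
Proof.
have [_ un H] := cubicP (ltn_ord u).
apply: uniq_perm => //; first by rewrite map_inj_uniq ?enum_uniq //; apply: val_inj.
move=> j; apply/mapP/idP => [[v]|jin].
  by rewrite mem_enum inE adjE => ? ->.
have [ltj _ _] := H _ jin.
by exists (Ordinal ltj); rewrite // mem_enum inE adjE.
Qed.

Lemma lgraph_cubic : cubic lgraph.
Proof.
move=> u; rewrite cardE -(size_map val) (perm_size (nbh_perm u)).
by have [] := cubicP (ltn_ord u).
Qed.

Lemma lgraph_order : graph_order lgraph = n.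
Proof. exact: card_ord. Qed.

End ListGraph.

(** * Counting the cycles of a permutation by short-circuiting points *)

Section CycleCount.
Local Open Scope group_scope.

(** A permutation is listed as pairs (x, f x).  Short-circuiting its first point
    a, that is, redirecting to b = f a whatever used to point to a, leaves the
    number of cycles unchanged unless a was a fixed point, in which case exactly
    one cycle disappears.  The first argument is fuel. *)
Fixpoint cycle_count_rec (T : eqType) (k : nat) (l : seq (T * T)) : nat :=
  if k is k'.+1 then
    if l is (a, b) :: l' then
      (b == a) + cycle_count_rec k'
        [seq (p.1, if p.2 == a then b else p.2) | p <- l']
    else 0
  else 0.

Definition cycle_count (T : eqType) (l : seq (T * T)) : nat :=
  cycle_count_rec (size l) l.

Definition graph_on (T : Type) (f : T -> T) (s : seq T) : seq (T * T) :=
  [seq (x, f x) | x <- s].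

Lemma cycle_count_cons (T : eqType) (a b : T) l :
  cycle_count ((a, b) :: l) =
    ((b == a) + cycle_count [seq (p.1, if p.2 == a then b else p.2) | p <- l])%N.
Proof. by rewrite /cycle_count /= size_map. Qed.

Lemma cycle_count_map (T U : eqType) (h : T -> U) (l : seq (T * T)) :
  injective h ->
  cycle_count [seq (h p.1, h p.2) | p <- l] = cycle_count l.
Proof.
move=> hI; have [k] := ubnP (size l); elim: k l => // k IH [|[a b] l] //= lt.
rewrite !cycle_count_cons (inj_eq hI) -[in RHS]IH ?size_map //.
congr (_ + cycle_count _)%N; rewrite -!map_comp; apply: eq_map => -[x y] /=.
by rewrite (inj_eq hI); case: ifP.
Qed.

Variable T : finType.

(** Short-circuiting a is multiplication by the transposition of a and its
    preimage, and the effect of a transposition on the number of orbits is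
    known; points outside s are fixed and count one orbit each. *)
Lemma porbits_cycle_count (p : {perm T}) (s : seq T) :
  uniq s -> (forall x, x \notin s -> p x = x) ->
  #|porbits p| = (cycle_count (graph_on p s) + (#|T| - size s))%N.
Proof.
elim: s p => [|a s IH] p /=.
  move=> _ fixp; have -> : p = 1 by apply/permP => x; rewrite perm1 fixp.
  rewrite /cycle_count /= subn0 add0n card_in_imset // => x y _ _.
  move=> /setP/(_ y); rewrite porbit_id => /porbitP[i].
  by rewrite expg1n perm1.
move=> /andP[aNs us] fixp.
pose q := tperm a (p^-1 a) * p.
have qE x : q x = if x == a then a else if p x == a then p a else p x.
  rewrite /q permM; case: tpermP => [->|->|/eqP/negPf -> xN].
  - by rewrite eqxx permKV.
  - by rewrite permKV eqxx; case: eqP => // E; rewrite -{1}E permKV.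
  by case: eqP => // pxa; case: xN; rewrite -pxa permK.
have := porbits_mul_tperm p a (p^-1 a); rewrite /= -/q.
rewrite porbit_sym.
have -> : p^-1 a \in porbit p a.
  by have := mem_porbit p^-1 1 a; rewrite expg1 porbitV.
rewrite (IH q us); last first.
  move=> x xNs; rewrite qE; case: eqP => // /eqP xNa.
  have -> : p x = x by apply: fixp; rewrite inE negb_or xNa.
  by rewrite (negPf xNa).
have -> : graph_on q s =
    [seq (e.1, if e.2 == a then p a else e.2) | e <- graph_on p s].
  rewrite /graph_on -map_comp; apply/eq_in_map => x xs /=; rewrite qE.
  by case: eqP => // xa; rewrite -xa xs in aNs.
rewrite addn0 cycle_count_cons.
set c := cycle_count _.
have lt : size s < #|T|.
  by have := max_card (mem (a :: s)); rewrite (card_uniqP _) //= aNs.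
rewrite -subnSK //; set r := (#|T| - _)%N.
have -> : (a != p^-1 a) = ~~ (p a == a).
  by rewrite -(inj_eq (@perm_inj _ p)) permKV eq_sym.
move=> H; apply: (@addIn (~~ (p a == a))); rewrite -H.
by case: (p a == a); rewrite /= ?addn0 ?addn1 ?add0n ?add1n ?addSn ?addnS.
Qed.

Lemma fcard_cycle_count (f : T -> T) (A : {set T}) (s : seq T) :
  injective f -> {in A, forall x, f x \in A} -> uniq s -> s =i A ->
  fcard f A = cycle_count (graph_on f s).
Proof.
move=> fI fA us sA.
pose g x := if x \in A then f x else x.
have gI : injective g.
  move=> x y; rewrite /g; case: ifP => [xA|xA]; case: ifP => [yA|yA] //.
  - exact: fI.
  - by move=> E; have := fA _ xA; rewrite E yA.
  by move=> E; have := fA _ yA; rewrite -E xA.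
pose p := perm gI.
have pX x i : x \in A -> (p ^+ i) x = iter i f x /\ iter i f x \in A.
  move=> xA; elim: i => [|i [IH1 IH2]]; first by rewrite perm1.
  by rewrite expgSr permM IH1 permE /= /g IH2; split=> //; apply: fA.
have pF x i : x \notin A -> (p ^+ i) x = x.
  move=> xA; elim: i => [|i IH]; first by rewrite perm1.
  by rewrite expgSr permM IH permE /g (negPf xA).
have pC x y : x \in A -> (y \in porbit p x) = fconnect f x y.
  move=> xA; apply/porbitP/idP => [[i ->]|/iter_findex <-].
    by rewrite (proj1 (pX _ _ xA)) fconnect_iter.
  by exists (findex f x y); rewrite (proj1 (pX _ _ xA)).
have clA : fclosed f A.
  move=> x _ /eqP <-; apply/idP/idP => [/fA //|].
  move=> fxA; apply: contraLR isT => xNA.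
  have : iter (fingraph.order f x).-1 f (f x) \in A by apply: (proj2 (pX _ _ fxA)).
  by rewrite -iterSr prednK ?order_gt0 // iter_order // (negPf xNA).
have symf := fconnect_sym fI.
have := @porbits_cycle_count p s us.
have -> : graph_on p s = graph_on f s.
  by apply/eq_in_map => x; rewrite sA permE /g => ->.
have -> : porbits p = [set porbit p x | x in A] :|: [set [set x] | x in ~: A].
  apply/setP => B; rewrite inE; apply/imsetP/orP => [[x _ ->]|[]/imsetP[x xA ->]].
  - case: (boolP (x \in A)) => xA; [left|right]; apply/imsetP; exists x => //.
      by rewrite inE.
    apply/setP => y; rewrite inE; apply/porbitP/eqP => [[i]|->].
      by rewrite pF.
    by exists 0; rewrite perm1.
  - by exists x.
  rewrite inE in xA; exists x => //; apply/setP => y; rewrite inE.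
  apply/eqP/porbitP => [->|[i]]; first by exists 0; rewrite perm1.
  by rewrite pF.
rewrite cardsU [X in _ - X]eq_card0 ?subn0; last first.
  move=> B; rewrite inE; apply/negP => /andP[/imsetP[x xA ->] /imsetP[y yA]].
  move=> E; have := porbit_id p x; rewrite E inE => /eqP xy.
  by rewrite inE -xy xA in yA.
rewrite [X in (_ + X)%N]card_imset; last exact: set1_inj.
rewrite [#|~: A|]cardsCs setCK -(card_uniqP us) (eq_card sA) => H.
have {}H : #|[set porbit p x | x in A]| = cycle_count (graph_on f s).
  apply/eqP; rewrite -(eqn_add2r (#|T| - #|A|)%N); apply/eqP/H => x.
  by rewrite sA permE /g => /negPf ->.
rewrite -H /n_comp_mem.
have -> : [set porbit p x | x in A] =
   [set porbit p x | x in [predI froots f & A]].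
  apply/setP => B; apply/imsetP/imsetP => [[x xA ->]|[x]].
    have cA : froot f x \in A by rewrite -(closed_connect clA (connect_root _ x)).
    exists (froot f x); first by apply/andP; split; first exact: (roots_root symf).
    apply/eqP; rewrite eq_porbit_mem porbit_sym pC //; exact: connect_root.
  by rewrite inE => /andP[_ xA] ->; exists x.
rewrite card_in_imset // => x y; rewrite !inE => /andP[/eqP rx xA] /andP[/eqP ry yA] E.
rewrite -rx -ry; apply/(fingraph.rootP symf); rewrite -pC // -eq_porbit_mem.
by apply/eqP; rewrite E.
Qed.

End CycleCount.

(** * Rotations at a vertex of degree three *)

Section RotationsAtAVertex.
Variable T : finType.

Lemma porbit_sub (p : {perm T}) (B : {pred T}) x :
  x \in B -> (forall u, u \in B -> p u \in B) -> {subset porbit p x <= B}.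
Proof.
move=> xB clB u /porbitP[i ->]; elim: i => [|i IH]; first by rewrite perm1.
by rewrite expgSr permM clB.
Qed.

Lemma porbit3 (p : {perm T}) x y z :
  p x = y -> p y = z -> p z = x -> porbit p x =i [:: x; y; z].
Proof.
move=> px py pz u; apply/idP/idP => [|uxyz].
  apply: porbit_sub; first exact: mem_head.
  by move=> v; rewrite !inE => /or3P[]/eqP->; rewrite ?px ?py ?pz eqxx ?orbT.
apply/porbitP; move: uxyz; rewrite !inE => /or3P[]/eqP->.
- by exists 0; rewrite perm1.
- by exists 1; rewrite expg1.
by exists 2; rewrite expgSr permM expg1 px.
Qed.

(** Three points have exactly two cyclic orders. *)
Lemma rotation_at (l : seq T) (A : {set T}) (s : {perm T}) :
  uniq l -> size l = 3 -> l =i A ->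
  reflect (s =1 next l \/ s =1 prev l)
    (perm_on A s && [forall u in A, porbit s u == A]).
Proof.
case: l => [|x [|y [|z []]]] //= /and3P[]; rewrite !inE negb_or.
move=> /andP[/negPf xy /negPf xz] /negPf yz _ _ lA.
have [yx zx zy] : [/\ y == x = false, z == x = false & z == y = false].
  by split; rewrite eq_sym.
have memA u : (u \in A) = [|| u == x, u == y | u == z] by rewrite -lA !inE.
have nextE u : next [:: x; y; z] u =
    if u == x then y else if u == y then z else if u == z then x else u by [].
have prevE u : prev [:: x; y; z] u =
    if u == y then x else if u == z then y else if u == x then z else u by [].
have suff_cycle a b c : [:: a; b; c] =i [:: x; y; z] ->
    s a = b -> s b = c -> s c = a -> (forall u, u \notin A -> s u = u) ->
    perm_on A s && [forall u in A, porbit s u == A].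
  move=> abc sa sb sc fixs; apply/andP; split.
    by apply/subsetP => u; rewrite !inE; apply: contraR => /fixs ->.
  have oa : porbit s a = A by apply/setP=> u; rewrite (porbit3 sa sb sc) abc lA.
  by apply/forall_inP => u; rewrite -oa -eq_porbit_mem.
apply: (iffP idP) => [/andP[onA /forall_inP orbA]|[]sE]; last first.
- apply: (suff_cycle x z y); rewrite ?sE ?prevE ?eqxx ?xy ?xz ?yz ?yx ?zx ?zy //.
    by move=> u; rewrite !inE; case: (u == x) (u == y) (u == z) => [] [] [].
  by move=> u; rewrite memA sE prevE; case: eqP; case: eqP; case: eqP.
- apply: (suff_cycle x y z); rewrite ?sE ?nextE ?eqxx ?xy ?xz ?yz ?yx ?zx ?zy //.
  by move=> u; rewrite memA sE nextE; case: eqP; case: eqP; case: eqP.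
have sA u : u \in A -> s u \in A by rewrite (perm_closed _ onA).
have proper u (B : {pred T}) v : u \in A -> u \in B -> v \in A -> v \notin B ->
    (forall w, w \in B -> s w \in B) -> False.
  move=> uA uB vA vB clB; move: vB; apply/negP/negPn.
  by apply: (porbit_sub uB clB); rewrite (eqP (orbA u uA)).
have fixN u : u \in A -> s u != u.
  move=> uA; apply/eqP => su.
  have [v vA vu] : exists2 v, v \in A & v != u.
    move: uA; rewrite memA; case/or3P => /eqP->; [exists y|exists x|exists x];
      by rewrite ?memA ?eqxx ?orbT ?xy ?xz ?yx.
  apply: (proper u (pred1 u) v); rewrite ?inE // => w; rewrite !inE.
  by move=> /eqP->; rewrite su.
have swapN u v w : [:: u; v; w] =i A -> w != u -> w != v -> s u = v -> s v != u.
  move=> uvw wu wv su; apply/eqP => sv.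
  apply: (proper u (pred2 u v) w); rewrite -?uvw ?inE ?eqxx ?orbT //.
    by rewrite negb_or wu.
  by move=> t; rewrite !inE => /orP[]/eqP->; rewrite ?su ?sv eqxx ?orbT.
have [xA yA zA] : [/\ x \in A, y \in A & z \in A] by rewrite !memA !eqxx !orbT.
have outA u : u \notin A -> s u = u by move=> uA; apply: (out_perm onA).
have perm3 : [:: x; z; y] =i A.
  by move=> u; rewrite memA !inE; case: (u == x) (u == y) (u == z) => [] [] [].
(* Once s x is known to be y or z, injectivity determines the rest. *)
move: (sA x xA) (fixN x xA); rewrite memA => /or3P[]/eqP sx; rewrite ?sx ?eqxx // => _.
  left; have sy : s y = z.
    move: (sA y yA) (fixN y yA); rewrite memA => /or3P[]/eqP // sy; last by rewrite sy eqxx.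
    by have := swapN x y z lA; rewrite zx zy sy eqxx => /(_ isT isT sx).
  have sz : s z = x.
    move: (sA z zA); rewrite memA => /or3P[]/eqP // => sz.
      by move/eqP: zx => []; apply: (@perm_inj _ s); rewrite sz.
    by move/eqP: zy => []; apply: (@perm_inj _ s); rewrite sz sy.
  move=> u; rewrite nextE.
  case: eqP => [->//|/eqP/negPf ux]; case: eqP => [->//|/eqP/negPf uy].
  by case: eqP => [->//|/eqP/negPf uz]; apply: outA; rewrite memA ux uy uz.
right; have sz : s z = y.
  move: (sA z zA) (fixN z zA); rewrite memA => /or3P[]/eqP // sz; last by rewrite sz eqxx.
  by have := swapN x z y perm3; rewrite yx yz sz eqxx => /(_ isT isT sx).
have sy : s y = x.
  move: (sA y yA); rewrite memA => /or3P[]/eqP // => sy.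
    by move/eqP: yz => []; apply: (@perm_inj _ s); rewrite sz.
  by move/eqP: yx => []; apply: (@perm_inj _ s); rewrite sy sx.
move=> u; rewrite prevE.
case: eqP => [->//|/eqP/negPf ux]; case: eqP => [->//|/eqP/negPf uy].
by case: eqP => [->//|/eqP/negPf uz]; apply: outA; rewrite memA ux uy uz.
Qed.

End RotationsAtAVertex.

(** * Summing over all rotation systems, vertex by vertex *)

Section Collect.
Variables (S : eqType) (W : Type) (add : W -> W -> W).

(** Merging of equal states is what turns the enumeration of 2^22 rotation
    systems, or of all edge sets, into a computation with a few hundred
    states. *)
Fixpoint tally_in (s : S) (w : W) (l : seq (S * W)) : seq (S * W) :=
  if l is (s', w') :: l' then
    if s == s' then (s', add w w') :: l' else (s', w') :: tally_in s w l'
  else [:: (s, w)].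

Definition collect (l : seq (S * W)) : seq (S * W) :=
  foldr (fun sw => tally_in sw.1 sw.2) [::] l.

Lemma big_collect (R : Type) (idx : R) (op : Monoid.com_law idx)
    (f : S -> W -> R) l :
  (forall s w w', f s (add w w') = op (f s w) (f s w')) ->
  \big[op/idx]_(sw <- collect l) f sw.1 sw.2 =
  \big[op/idx]_(sw <- l) f sw.1 sw.2.
Proof.
move=> fD; elim: l => [|[s w] l IH] //=; rewrite big_cons -{}IH /=.
elim: (collect l) => [|[s' w'] k IH] /=; first by rewrite big_cons.
case: eqP => [->|_]; first by rewrite !big_cons /= fD Monoid.mulmA.
by rewrite !big_cons /= IH Monoid.mulmCA.
Qed.

Lemma collect_keys l : {subset map fst (collect l) <= map fst l}.
Proof.
elim: l => [|[s w] l IH] //= x; rewrite inE => /=.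
have {IH}: x \in map fst (collect l) -> x \in map fst l by apply: IH.
elim: (collect l) => [|[s' w'] k IH] /=; first by rewrite inE => _ ->.
case: eqP => [<-|_] /=; rewrite !inE => sub; first by move=> /orP[->//|xk]; rewrite sub ?xk orbT.
case/orP => [xs'|xk]; first by rewrite sub ?xs' ?orbT.
by apply: IH xk => xk'; rewrite sub ?xk' ?orbT.
Qed.
End Collect.

Section WeightedCounts.

Fixpoint addw (w w' : seq N) : seq N :=
  match w, w' with
  | a :: v, b :: v' => N.add a b :: addw v v'
  | [::], _ => w'
  | _, [::] => w
  end.

Variable V : nmodType.
Implicit Types (h : nat -> V) (w : seq N).

(** A weight w stands for a formal combination of natural numbers (numbers of
    faces), its k-th entry being the multiplicity of k; [weigh h w] is its
    image under h. *)
Fixpoint weigh h w : V :=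
  if w is a :: w' then (h 0 *+ N.to_nat a + weigh (fun k => h k.+1) w')%R
  else 0%R.

Lemma weigh_addw h w w' : (weigh h (addw w w') = weigh h w + weigh h w')%R.
Proof.
elim: w w' h => [|a w IH] [|b w'] h /=; rewrite ?GRing.add0r ?GRing.addr0 //.
by rewrite N2Nat.inj_add GRing.mulrnDr IH GRing.addrACA.
Qed.

Lemma weigh_shift h c w :
  weigh h (ncons c N0 w) = weigh (fun k => h (c + k)%N) w.
Proof. by elim: c h => // c IH h; rewrite /= GRing.add0r IH. Qed.

Lemma eq_weigh h h' w : h =1 h' -> weigh h w = weigh h' w.
Proof. by elim: w h h' => //= a w IH h h' E; rewrite E (IH _ (fun k => h' k.+1)). Qed.

Lemma weighD h h' w :
  (weigh (fun k => h k + h' k) w = weigh h w + weigh h' w)%R.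
Proof.
elim: w h h' => [|a w IH] h h' /=; first by rewrite GRing.addr0.
by rewrite (IH (fun k => h k.+1)) GRing.mulrnDl GRing.addrACA.
Qed.
End WeightedCounts.

Section Embeddings.
Variable nb : nat -> seq nat.

Local Notation dart := (nat * nat)%type.

Definition turn (v : nat) (b : bool) (d : dart) : dart :=
  if d.1 == v then (v, (if b then next else prev) (nb v) d.2) else d.

(** The face map factors as: reverse the dart (u, v) to (v, u), then turn at the
    new tail v.  [turns vs bs] performs all the turns at the vertices vs, in the
    directions bs, and [flips] below is the reversal. *)
Fixpoint turns (vs : seq nat) (bs : seq bool) (d : dart) : dart :=
  match vs, bs with
  | v :: vs', b :: bs' => turns vs' bs' (turn v b d)
  | _, _ => d
  end.

Definition apply_snd (f : dart -> dart) (l : seq (dart * dart)) :=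
  [seq (e.1, f e.2) | e <- l].

Fixpoint eliminate (k : nat) (l : seq (dart * dart)) :
    nat * seq (dart * dart) :=
  match k, l with
  | k'.+1, (a, b) :: l' =>
      let: (c, l'') :=
        eliminate k' [seq (e.1, if e.2 == a then b else e.2) | e <- l'] in
      ((b == a) + c, l'')
  | _, _ => (0, l)
  end.

Fixpoint bool_seqs (k : nat) : seq (seq bool) :=
  if k is k'.+1 then
    [seq true :: bs | bs <- bool_seqs k'] ++
    [seq false :: bs | bs <- bool_seqs k']
  else [:: [::]].

(** A state lists a permutation of the darts whose tails are not yet processed.
    Processing v composes it with either turn at v and short-circuits the darts
    at v, recording how many cycles got closed. *)
Definition embed_step (states : seq (seq (dart * dart) * seq N)) v :=
  collect addw (flatten [seq
    [seq let: (c, st) := eliminate (size (nb v)) (apply_snd (turn v b) sw.1) in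
         (st, ncons c N0 sw.2) | b <- [:: true; false]]
    | sw <- states]).

Definition flips (vs : seq nat) : seq (dart * dart) :=
  flatten [seq [seq ((u, v), (v, u)) | v <- nb u] | u <- vs].

Definition face_distribution (vs : seq nat) : seq N :=
  foldr (fun sw => addw sw.2) [::]
    (foldl embed_step [:: (flips vs, [:: N.one])] vs).

Definition star (v : nat) : seq dart := [seq (v, u) | u <- nb v].

(** Short-circuiting points commutes with a later permutation R that fixes
    them: this is why the darts at v can be forgotten before the rotations of
    the other vertices are chosen. *)
Lemma eliminateP (R : dart -> dart) k l c l' :
  injective R -> {in [seq e.1 | e <- take k l], forall a, R a = a} ->
  eliminate k l = (c, l') ->
  cycle_count (apply_snd R l) = (c + cycle_count (apply_snd R l'))%N.
Proof.
move=> RI; elim: k l c => [|k IH] [|[a b] l] c /= fixR; try by case=> <- <-.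
have Ra : R a = a by apply: fixR; exact: mem_head.
case E: eliminate => [c' l''] [<- El]; rewrite El in E; rewrite cycle_count_cons.
rewrite -{1}Ra (inj_eq RI) -addnA; congr (_ + _)%N.
rewrite -(IH _ _ _ E); last first.
  move=> x xin; apply: fixR; rewrite inE; apply/orP; right; move: xin.
  by rewrite -!map_take -!map_comp.
congr cycle_count; rewrite /apply_snd -!map_comp; apply: eq_map => -[x y] /=.
by rewrite -{1}Ra (inj_eq RI); case: ifP.
Qed.

Lemma eliminate_keys k l :
  [seq e.1 | e <- (eliminate k l).2] = drop k [seq e.1 | e <- l].
Proof.
elim: k l => [|k IH] [|[a b] l] //=.
case E: eliminate => [c l'] /=.
by have := IH [seq (e.1, if e.2 == a then b else e.2) | e <- l];
  rewrite E /= => ->; rewrite -map_comp.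
Qed.

Hypothesis nbU : forall v, uniq (nb v).

Lemma turn_inj v b : injective (turn v b).
Proof.
move=> [x y] [x' y']; rewrite /turn /=.
case: eqP => [->|xv]; case: eqP => [->|xv'] // [].
- case: b => E; congr (_, _); first exact: (can_inj (prev_next (nbU v))) E.
  exact: (can_inj (next_prev (nbU v))) E.
- by move=> E; case: xv'.
by move=> E; case: xv.
Qed.

Lemma turn1 v b d : (turn v b d).1 = d.1.
Proof. by rewrite /turn; case: eqP. Qed.

Lemma turns_inj vs bs : injective (turns vs bs).
Proof.
elim: vs bs => [|v vs IH] [|b bs] // x y /=.
by move=> /IH /turn_inj.
Qed.

Lemma turns_id vs bs d : d.1 \notin vs -> turns vs bs d = d.
Proof.
elim: vs bs d => [|v vs IH] [|b bs] d //=.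
by rewrite inE negb_or => /andP[dv dvs]; rewrite IH /turn (negPf dv).
Qed.

Lemma turns_map (b : nat -> bool) vs d : uniq vs -> d.1 \in vs ->
  turns vs (map b vs) d =
    (d.1, (if b d.1 then next else prev) (nb d.1) d.2).
Proof.
elim: vs d => //= v vs IH d /andP[vNvs uvs]; rewrite inE.
case: eqP => [dv _|dv /= dvs]; first by rewrite turns_id ?turn1 /turn dv ?eqxx.
have -> : turn v (b v) d = d by rewrite /turn; case: eqP.
exact: IH.
Qed.

Section Sum.
Variables (V : nmodType) (h : nat -> V).

(** The invariant of the dynamic programme: what a state, with c cycles already
    closed, still contributes to the sum of h over all completions. *)
Definition embed_sum (vs : seq nat) (st : seq (dart * dart)) (c : nat) : V :=
  (\sum_(bs <- bool_seqs (size vs))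
     h (c + cycle_count (apply_snd (turns vs bs) st))%N)%R.

Lemma embed_sum_cons v vs st c :
  v \notin vs ->
  [seq e.1 | e <- st] = flatten [seq star u | u <- v :: vs] ->
  (embed_sum (v :: vs) st c =
    \sum_(b <- [:: true; false])
      embed_sum vs (eliminate (size (nb v)) (apply_snd (turn v b) st)).2
        (c + (eliminate (size (nb v)) (apply_snd (turn v b) st)).1)%N)%R.
Proof.
move=> vN keys; rewrite /embed_sum /= big_cat !big_map !big_cons big_nil /=.
rewrite GRing.addr0.
suff E b : (\sum_(bs <- bool_seqs (size vs))
      h (c + cycle_count (apply_snd (turns (v :: vs) (b :: bs)) st))%N =
    \sum_(bs <- bool_seqs (size vs))
      h (c + (eliminate (size (nb v)) (apply_snd (turn v b) st)).1 +
         cycle_count (apply_snd (turns vs bs)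
           (eliminate (size (nb v)) (apply_snd (turn v b) st)).2))%N)%R.
  by rewrite -2!E.
apply: eq_bigr => bs _; rewrite -addnA; congr (h (_ + _)%N).
case E: eliminate => [c' st'] /=.
rewrite -(eliminateP _ _ E); last 2 first.
- exact: turns_inj.
- move=> a; rewrite map_take -map_comp -/(map fst st).
  have -> : map (fst \o (fun e : dart * dart => (e.1, turn v b e.2))) st = map fst st.
    exact: eq_map.
  rewrite keys /= take_cat size_map ltnn subnn take0 cats0.
  by move=> /mapP[u _ ->]; rewrite turns_id.
by rewrite /apply_snd -map_comp.
Qed.

Lemma embed_keys v vs (states : seq (seq (dart * dart) * seq N)) :
  {in map fst states, forall st : seq (dart * dart),
     map fst st = flatten [seq star u | u <- v :: vs]} ->
  {in map fst (embed_step states v), forall st : seq (dart * dart),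
     map fst st = flatten [seq star u | u <- vs]}.
Proof.
move=> keys st.
move=> /collect_keys/mapP[_ /flatten_mapP[[st0 w] st0w /mapP[b _ ->]] ->] /=.
case E: (eliminate _ _) => [c st1] /=; rewrite -[st1]/((c, st1).2) -E.
rewrite eliminate_keys -map_comp.
have -> : map (fst \o (fun e : dart * dart => (e.1, turn v b e.2))) st0 = map fst st0.
  exact: eq_map.
rewrite keys /=; last by apply/mapP; exists (st0, w).
by rewrite drop_size_cat // size_map.
Qed.

Lemma embed_steps vs (states : seq (seq (dart * dart) * seq N)) :
  uniq vs ->
  {in map fst states, forall st : seq (dart * dart),
     map fst st = flatten [seq star u | u <- vs]} ->
  (\sum_(sw <- states) weigh (embed_sum vs sw.1) sw.2 =
   \sum_(sw <- foldl embed_step states vs) weigh (embed_sum [::] sw.1) sw.2)%R.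
Proof.
elim: vs states => //= v vs IH states /andP[vN uvs] keys.
rewrite -{}IH //; last exact: embed_keys.
rewrite /embed_step (big_collect (f := fun st => weigh (embed_sum vs st))); last by move=> *; apply: weigh_addw.
rewrite big_flatten /= big_map big_seq [RHS]big_seq; apply: eq_bigr => -[st w] sw.
have kst : map fst st = flatten [seq star u | u <- v :: vs].
  by apply: keys; apply/mapP; exists (st, w).
rewrite (eq_weigh _ (fun c => embed_sum_cons c vN kst)).
have -> : forall f : bool -> nat -> V,
   (weigh (fun c => \sum_(b <- [:: true; false]) f b c) w =
    \sum_(b <- [:: true; false]) weigh (f b) w)%R.
  by move=> f; rewrite !big_cons big_nil GRing.addr0 -weighD; apply: eq_weigh
    => c; rewrite !big_cons big_nil GRing.addr0.
rewrite !big_cons !big_nil; congr (_ + (_ + _))%R;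
  case: (eliminate _ _) => c st' /=; rewrite weigh_shift; apply: eq_weigh => k;
  by rewrite addnC.
Qed.

(** After the last vertex the states are empty, and only their weights
    remain. *)
Lemma face_distributionP vs : uniq vs ->
  (embed_sum vs (flips vs) 0 = weigh h (face_distribution vs))%R.
Proof.
move=> uvs; pose states := [:: (flips vs, [:: N.one])].
have keys0 : {in map fst states, forall st : seq (dart * dart),
     map fst st = flatten [seq star u | u <- vs]}.
  move=> st; rewrite inE => /eqP -> /=; rewrite map_flatten -map_comp.
  by congr flatten; apply: eq_map => u /=; rewrite -map_comp.
have := embed_steps uvs keys0.
rewrite big_seq1 /= GRing.mulr1n GRing.addr0 => ->.
rewrite /face_distribution -/states.
have : {in map fst (foldl embed_step states vs), forall st, st = [::]}.
  have {keys0}: {in map fst states, forall st : seq (dart * dart),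
     map fst st = flatten [seq star u | u <- vs]} by [].
  elim: vs states {uvs} => [|v vs IH] states keys /= st.
    by move=> /keys; case: st.
  by apply: IH => {}st /embed_keys; apply.
elim: (foldl _ _ _) => [|[st w] l IH] keys; first by rewrite big_nil.
rewrite big_cons /= weigh_addw -IH => [|x xl]; last first.
  by apply: keys; rewrite inE xl orbT.
rewrite (keys st) ?mem_head //; congr (_ + _)%R; apply: eq_weigh => k.
by rewrite /embed_sum big_seq1 addn0.
Qed.

End Sum.
End Embeddings.

(** * The distribution of the number of faces *)

Lemma mem_bool_seqs k bs : (bs \in bool_seqs k) = (size bs == k).
Proof.
have mem_cons (b b' : bool) s (l : seq (seq bool)) :
    (b :: s \in [seq b' :: bs' | bs' <- l]) = (b == b') && (s \in l).
  apply/mapP/andP => [[x xl [-> ->]]|[/eqP -> sl]]; last by exists s.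
  by rewrite eqxx.
elim: k bs => [|k IH] [|b bs] //=; rewrite mem_cat.
  by case: mapP => [[x _]|_] //; case: mapP => [[x _]|_].
by rewrite eqSS -IH !mem_cons; case: b; rewrite /= ?orbF.
Qed.

Lemma bool_seqs_uniq k : uniq (bool_seqs k).
Proof.
elim: k => //= k IH; rewrite cat_uniq !map_inj_uniq ?IH; try by move=> x y [].
by rewrite andbT; apply/hasPn => _ /mapP[x _ ->]; apply/negP => /mapP[].
Qed.

Section GenusDistribution.
Variables (m : nat) (L : seq (seq nat)).
Hypothesis cub : cubic_lists m L.
Let n := m.+1.
Let G := lgraph m L.
Let nb i := nth [::] L i.

Definition onb (v : G) : seq G := pmap insub (nb v).

Lemma val_onb v : map val (onb v) = nb v.
Proof.
rewrite /onb pmap_filter; last exact: insubK.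
apply/all_filterP/allP => j jv; rewrite isSome_insub.
by have [_ _ /(_ j jv)[]] := cubicP cub (ltn_ord v).
Qed.

Lemma onb_uniq v : uniq (onb v).
Proof. by rewrite -(map_inj_uniq val_inj) val_onb (nb_uniq cub). Qed.

Lemma size_onb v : size (onb v) = 3.
Proof. by rewrite -(size_map val) val_onb; have [] := cubicP cub (ltn_ord v). Qed.

Lemma mem_onb v u : (u \in onb v) = adj v u.
Proof. by rewrite (adjE cub) -(mem_map val_inj) val_onb. Qed.

Definition rot_perm (b : bool) (v : G) : {perm G} :=
  if b then perm (can_inj (prev_next (onb_uniq v)))
  else perm (can_inj (next_prev (onb_uniq v))).

Lemma rot_permE b v u :
  rot_perm b v u = (if b then next else prev) (onb v) u.
Proof. by case: b; rewrite permE. Qed.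

Lemma rot_perm_neq v : rot_perm true v != rot_perm false v.
Proof.
apply/eqP => /permP; move: (onb_uniq v) (size_onb v) (rot_permE true v) (rot_permE false v).
case: (onb v) => [|x [|y [|z []]]] //= un _ tE fE /(_ x).
rewrite tE fE /= ?eqxx; move: un; rewrite !inE negb_or => /and3P[/andP[/negPf xy /negPf xz] /negPf yz _].
by rewrite xy xz => yz'; rewrite yz' eqxx in yz.
Qed.

Definition rho_of (b : {ffun G -> bool}) : {ffun G -> {perm G}} :=
  [ffun v => rot_perm (b v) v].

Lemma rotation_systemP (rho : {ffun G -> {perm G}}) :
  rotation_system rho = [forall v, (rho v == rot_perm true v) || (rho v == rot_perm false v)].
Proof.
apply: eq_forallb => v.
apply/(rotation_at (rho v) (onb_uniq v) (size_onb v))/orP.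
- by move=> u; rewrite mem_onb inE.
- by case=> E; [left|right]; apply/eqP/permP => u; rewrite E rot_permE.
by case=> /eqP ->; [left|right] => u; rewrite rot_permE.
Qed.

(** A rotation system of a cubic graph is a family of independent binary
    choices. *)
Lemma sum_rotation_systems (V : nmodType) (F : {ffun G -> {perm G}} -> V) :
  (\sum_(rho | rotation_system rho) F rho = \sum_b F (rho_of b))%R.
Proof.
rewrite (reindex_onto rho_of (fun rho => [ffun v => rho v == rot_perm true v])).
  apply: eq_bigl => b; rewrite rotation_systemP; apply/andP; split.
    by apply/forallP => v; rewrite ffunE; case: (b v); rewrite eqxx ?orbT.
  apply/eqP/ffunP => v; rewrite !ffunE; case: (b v); rewrite ?eqxx //.
  by rewrite eq_sym (negPf (rot_perm_neq v)).
move=> rho; rewrite rotation_systemP => /forallP rhoE; apply/ffunP => v.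
rewrite !ffunE; case: eqP => [-> //|/eqP]; have := rhoE v.
by case: eqP => //= _ /eqP ->.
Qed.

Variable vs : seq nat.
Hypothesis vsP : perm_eq vs (iota 0 n).

Let vsU : uniq vs. Proof. by rewrite (perm_uniq vsP) iota_uniq. Qed.
Let mem_vs i : (i \in vs) = (i < n).
Proof. by rewrite (perm_mem vsP) mem_iota. Qed.

Lemma face_count_turns (b : {ffun G -> bool}) :
  face_count (rho_of b) =
  cycle_count (apply_snd (turns nb vs [seq b (inord i) | i <- vs]) (flips nb vs)).
Proof.
pose ds : seq (G * G) :=
  [seq (u, v) | u <- map inord vs, v <- onb u].
have dsU : uniq ds.
  apply: allpairs_uniq_dep.
  - rewrite map_inj_in_uniq // => i j; rewrite !mem_vs => lti ltj.
    by move=> /(congr1 val); rewrite /= !inordK.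
  - by move=> u _; apply: onb_uniq.
  by move=> [u v] [u' v'] _ _ /= [-> ->].
have dsE : ds =i darts G.
  move=> [u v]; rewrite [RHS]inE; apply/allpairsPdep/idP.
    by move=> [u' [v' [_ + [-> ->]]]]; rewrite mem_onb.
  move=> uv; exists u, v; rewrite mem_onb; split=> //.
  by rewrite -[u]inord_val map_f // mem_vs.
have fmI : injective (face_map (rho_of b)).
  move=> [u v] [u' v']; rewrite /face_map /= => -[-> E].
  by congr (_, _); apply: perm_inj E.
rewrite /face_count (fcard_cycle_count fmI _ dsU dsE); last first.
  move=> [u v]; rewrite ![_ \in darts G]inE => uv.
  suff: rho_of b v u \in onb v by rewrite mem_onb.
  rewrite ffunE rot_permE.
  have uin : u \in onb v by rewrite mem_onb adj_sym.
  by case: (b v); rewrite ?mem_next ?mem_prev.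
have hI : injective (fun d : G * G => (val d.1, val d.2)).
  by move=> [u v] [u' v'] /= [/val_inj -> /val_inj ->].
rewrite -(cycle_count_map _ hI); congr cycle_count.
rewrite /graph_on /apply_snd /flips /ds !map_allpairs allpairs_mapl.
congr flatten; apply/eq_in_map => i; rewrite mem_vs => lti.
rewrite -{1}[nb i]/(nb (Ordinal lti)) -val_onb.
have <- : inord i = Ordinal lti by apply: val_inj; rewrite /= inordK.
rewrite -map_comp; apply/eq_in_map => v viu /=.
rewrite turns_map //= ?mem_vs //.
rewrite /face_map /= ffunE rot_permE inord_val inordK //.
congr (_, _); congr (_, _); rewrite -val_onb -{2}(inordK lti).
by case: (b v); rewrite ?(next_map val_inj) ?(prev_map val_inj) ?onb_uniq.
Qed.

(** Taking h to be a monomial, an indicator, or anything additive gives every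
    statistic of the genus distribution from one computation. *)
Lemma sum_face_count (V : nmodType) (h : nat -> V) :
  (\sum_(rho : {ffun G -> {perm G}} | rotation_system rho) h (face_count rho) =
   weigh h (face_distribution nb vs))%R.
Proof.
rewrite sum_rotation_systems -face_distributionP //; last by move=> v; apply: (nb_uniq cub).
rewrite /embed_sum.
pose code (b : {ffun G -> bool}) := [seq b (inord i) | i <- vs].
have sz : size vs = n by rewrite (perm_size vsP) size_iota.
have codeI : injective code.
  move=> b b' E; apply/ffunP => v.
  have /eq_in_map/(_ (val v)) := E; rewrite mem_vs ltn_ord inord_val.
  exact.
rewrite (perm_big (map code (index_enum _))) /=.
  by rewrite big_map; apply: eq_bigr => b _; rewrite face_count_turns.
apply: uniq_perm; rewrite ?bool_seqs_uniq ?map_inj_uniq ?index_enum_uniq //.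
move=> bs; rewrite mem_bool_seqs; apply/eqP/mapP => [szbs|[b _ ->]]; last first.
  by rewrite size_map.
exists [ffun v : G => nth false bs (index (val v) vs)]; first by rewrite mem_index_enum.
apply: (@eq_from_nth _ false); rewrite ?size_map // => i lti.
have ltiv : i < size vs by rewrite -szbs.
rewrite (nth_map 0) // ffunE /= inordK -?mem_vs ?mem_nth //.
by rewrite index_uniq.
Qed.

End GenusDistribution.

(** * Genus polynomial and minimum genus *)

Section GenusPolynomial.
Import Order.TTheory GRing.Theory Num.Theory.

(** [minn] has no neutral element, so the usual lemmas on iterated monoid
    operations do not apply. *)
Lemma bigminn_eq (I : finType) (P : pred I) (F : I -> nat) d v :
  v <= d -> (exists2 j, P j & F j = v) -> (forall i, P i -> v <= F i) ->
  \big[minn/d]_(i | P i) F i = v.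
Proof.
move=> led [j Pj Fj] low; apply/eqP; rewrite eqn_leq; apply/andP; split.
  rewrite -Fj; elim: (index_enum I) (mem_index_enum j) => // i r IH.
  rewrite inE big_cons => /predU1P[<-|jr]; first by rewrite Pj geq_minl.
  by case: (P i); rewrite ?geq_min IH ?orbT.
by elim/big_ind: _ => // x y; rewrite leq_min => -> ->.
Qed.

Definition genus_number (G : sgraph) (g : nat) : nat :=
  \sum_(rho : {ffun G -> {perm G}} | rotation_system rho) (genus rho == g).

Lemma genus_poly_coef G g : ((genus_poly G)`_g = (genus_number G g)%:R)%R.
Proof.
rewrite /genus_poly coef_sum /genus_number natr_sum.
by apply: eq_bigr => rho _; rewrite coefXn eq_sym.
Qed.

Lemma min_genus_eq (G : sgraph) g :
  g <= #|G| -> genus_number G g != 0 ->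
  (forall g', g' < g -> genus_number G g' = 0) -> min_genus G = g.
Proof.
move=> leg gN0 low; apply: bigminn_eq => //.
  suff /exists_inP[rho rot /eqP <-] : [exists (rho : {ffun G -> {perm G}} |
      rotation_system rho), genus rho == g] by exists rho.
  apply: contraNT gN0; rewrite negb_exists_in => /forall_inP H.
  by rewrite /genus_number big1 // => rho /H /negPf ->.
move=> rho rot; rewrite leqNgt; apply/negP => /low /eqP.
by rewrite /genus_number sum_nat_eq0 => /forall_inP/(_ rho rot); rewrite eqxx.
Qed.

Fixpoint total_weight (sel : nat -> bool) (w : seq N) : N :=
  if w is a :: w' then
    N.add (if sel 0 then a else N0) (total_weight (fun k => sel k.+1) w')
  else N0.

Lemma weigh_total (sel : nat -> bool) w :
  weigh (fun k => nat_of_bool (sel k)) w = N.to_nat (total_weight sel w).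
Proof.
elim: w sel => //= a w IH sel; rewrite (IH (fun k => sel k.+1)) N2Nat.inj_add.
by congr addn; case: (sel 0); rewrite ?mul0rn ?natn.
Qed.

Section TwentyTwo.
Variable L : seq (seq nat).
Let G := lgraph 21 L.

(** With 22 vertices, Euler's formula reads g = 1 + 22/4 - F/2 = (13 - F)/2. *)
Lemma genus22 (rho : {ffun G -> {perm G}}) :
  genus rho = (13 - face_count rho)./2.
Proof.
rewrite /genus /euler_genus_formula card_ord; set F := face_count rho.
have [lt|ge] := ltnP F 14; last first.
  (* More than 13 faces would make the formula negative, and both sides 0. *)
  have -> : 13 - F = 0 by apply/eqP; rewrite subn_eq0 ltnW.
  apply/truncn0Pn; rewrite -ltNge; move: ge; rewrite -(ler_nat rat) => ge.
  lra.
rewrite -[F]/(val (Ordinal lt)); case: (Ordinal lt) => k /= {lt}.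
do 14?[case: k => [_|k];
  first by set g := half _; vm_compute in g; rewrite /g; apply: truncn_def; apply/andP; split; lra].
by [].
Qed.

Lemma genus_number22 vs g :
  cubic_lists 21 L -> perm_eq vs (iota 0 22) ->
  genus_number G g =
    N.to_nat (total_weight (fun k => (13 - k)./2 == g)
                (face_distribution (nth [::] L) vs)).
Proof.
move=> cub vsP; rewrite -weigh_total -(sum_face_count cub vsP).
by apply: eq_bigr => rho _; rewrite genus22.
Qed.

End TwentyTwo.

End GenusPolynomial.

(** * Bounds on invariants of cubic graphs *)

Lemma find_iota_eq (P : pred nat) n k :
  k < n -> P k -> (forall j, j < k -> ~~ P j) -> find P (iota 0 n) = k.
Proof.
move=> ltk Pk low; have sz : find P (iota 0 n) < n.
  by rewrite -[X in _ < X](size_iota 0) -has_find; apply/hasP; exists k; rewrite ?mem_iota.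
apply/eqP; rewrite eqn_leq; apply/andP; split; rewrite leqNgt; apply/negP => lt.
  by have := before_find 0 lt; rewrite nth_iota // add0n Pk.
have : has P (iota 0 n) by rewrite has_find size_iota.
by move=> /(nth_find 0); rewrite nth_iota // add0n; apply/negP/low.
Qed.

Lemma bigmax_ord (n : nat) (f : nat -> nat) :
  \max_(i < n) f i = foldr (fun i => maxn (f i)) 0 (iota 0 n).
Proof.
rewrite -(big_mkord xpredT) /index_iota subn0.
by elim: iota => [|i s IH]; rewrite ?big_nil ?big_cons //= IH.
Qed.

Lemma bigmin_ord (d n : nat) (f : nat -> nat) :
  \big[minn/d]_(i < n) f i = foldr (fun i => minn (f i)) d (iota 0 n).
Proof.
rewrite -(big_mkord xpredT) /index_iota subn0.
by elim: iota => [|i s IH]; rewrite ?big_nil ?big_cons //= IH.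
Qed.

Lemma bigmax_eq (I : finType) (P : pred I) (F : I -> nat) v :
  (exists2 j, P j & F j = v) -> (forall i, P i -> F i <= v) ->
  \max_(i | P i) F i = v.
Proof.
move=> [j Pj Fj] up; apply/eqP; rewrite eqn_leq; apply/andP; split.
  exact/bigmax_leqP.
by rewrite -Fj; apply: leq_bigmax_cond.
Qed.

Lemma card_gt2 (T : finType) (x y z : T) : uniq [:: x; y; z] -> 2 < #|T|.
Proof. by move=> /card_uniqP/= <-; apply: max_card. Qed.

Section CubicInvariants.
Variable G : sgraph.
Hypothesis cub : cubic G.

Lemma triangle_girth (a b c : G) :
  adj a b -> adj b c -> adj c a -> 3 <= #|G| -> girth G = 3.
Proof.
move=> ab bc ca le3; apply: find_iota_eq => //; last first.
  by move=> j; rewrite ltnS /has_cycle ltnNge => ->.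
apply/andP; split=> //; apply/existsP; exists [tuple a; b; c].
rewrite /ucycleb /= ab bc ca !inE negb_or.
have nadj (x y : G) : adj x y -> x != y.
  by apply: contraTneq => ->; rewrite adj_irrefl.
by rewrite (nadj _ _ ab) (nadj _ _ bc) eq_sym (nadj _ _ ca).
Qed.

(** Stated for an arbitrary relation, since it bounds the chromatic number
    through a triangle of the graph and the chromatic index through the three
    edges at a vertex. *)
Lemma triangle_colouring (T : finType) (r : rel T) (a b c : T) k :
  r a b -> r b c -> r c a -> colourable r k -> 2 < k.
Proof.
move=> ab bc ca /existsP[f /forallP fP].
have neq x y : r x y -> f x != f y by move=> xy; have /forallP/(_ y) := fP x; rewrite xy.
have /card_uniqP E : uniq [:: f a; f b; f c].
  by rewrite /= !inE negb_or (neq _ _ ab) (neq _ _ bc) eq_sym (neq _ _ ca).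
by have := max_card (mem [:: f a; f b; f c]); rewrite E card_ord.
Qed.

Lemma chromatic_rel_eq3 (T : finType) (r : rel T) (a b c : T) :
  r a b -> r b c -> r c a -> colourable r 3 -> 3 <= #|T| ->
  chromatic_rel r = 3.
Proof.
move=> ab bc ca c3 leT; apply: find_iota_eq => // j; rewrite ltnNge.
by apply: contra; apply: triangle_colouring ab bc ca.
Qed.

(** A vertex of a cubic graph dominates four vertices. *)
Lemma domination_lower (D : {set G}) :
  [forall v, (v \in D) || [exists u in D, adj v u]] -> #|G| <= 4 * #|D|.
Proof.
move=> /forallP dom.
have -> : #|G| = #|\bigcup_(u in D) (u |: nbh u)|.
  rewrite -cardsT; congr #|pred_of_set _|; apply/setP => v; rewrite inE.
  apply/esym/bigcupP; have /orP[vD|/exists_inP[u uD vu]] := dom v.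
    by exists v; rewrite // setU11.
  by exists u; rewrite // !inE adj_sym vu orbT.
rewrite mulnC -sum_nat_const.
elim/big_rec2: _ => [|u n A uD IH]; first by rewrite cards0.
rewrite (leq_trans (leq_card_setU _ _)) // leq_add // cardsU1 cub.
by rewrite inE adj_irrefl.
Qed.

Lemma edge_card (e : {set G}) : e \in edges G -> #|e| = 2.
Proof.
move=> /imsetP[[u v]]; rewrite inE /= => uv ->; rewrite cards2.
by case: eqP uv => // ->; rewrite adj_irrefl.
Qed.

Lemma matching_upper (M : {set {set G}}) :
  M \subset edges G -> trivIset M -> 2 * #|M| <= #|G|.
Proof.
move=> /subsetP sub /eqP; rewrite mulnC -sum_nat_const => E.
rewrite (leq_trans _ (max_card (mem (cover M)))) // -E leq_eqVlt.
by apply/orP; left; apply/eqP/eq_bigr => e /sub /edge_card.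
Qed.

(** A vertex of a clique with four or more elements would have its three
    neighbours pairwise adjacent. *)
Lemma clique_upper (K : {set G}) :
  (forall v : G, exists x y, [/\ x \in nbh v, y \in nbh v, x != y & ~~ adj x y]) ->
  [forall x in K, forall y in K, (x != y) ==> adj x y] -> #|K| <= 3.
Proof.
move=> nok4 /forall_inP clq; rewrite leqNgt; apply/negP => lt.
have [v vK] : exists v, v \in K by apply/set0Pn; rewrite -card_gt0 (leq_trans _ lt).
have sub : K :\ v \subset nbh v.
  apply/subsetP => u; rewrite !inE => /andP[uv uK].
  by have /forall_inP/(_ u uK) := clq v vK; rewrite eq_sym uv.
have E : K :\ v = nbh v.
  apply/eqP; rewrite eqEcard sub cub -ltnS.
  by have := cardsD1 v K; rewrite vK add1n => <-.
have [x [y [xv yv xy]]] := nok4 v; rewrite -!E !inE in xv yv.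
have /andP[_ xK] := xv; have /andP[_ yK] := yv.
by have /forall_inP/(_ y yK) := clq x xK; rewrite xy /= => ->.
Qed.

Lemma hamiltonian_circumference (c : #|G|.-tuple G) :
  2 < #|G| -> ucycleb (@adj G) c -> circumference G = #|G|.
Proof.
move=> lt2 uc; apply: bigmax_eq => [|i _]; last by rewrite -ltnS.
exists ord_max => //; rewrite /has_cycle lt2 /=; apply/existsP; by exists c.
Qed.

End CubicInvariants.

(** * Connectivity *)

Section Reach.
Variable m : nat.
Let n := m.+1.
Implicit Types (e : nat -> seq nat) (s : seq nat).

Fixpoint explore e (k : nat) (seen new : seq nat) : seq nat :=
  if k is k'.+1 then
    let new' := undup [seq j <- flatten [seq e i | i <- new] | j \notin seen] in
    explore e k' (new' ++ seen) new'
  else seen.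

Definition reaches_all e k (x : nat) (ys : seq nat) : bool :=
  all (mem (explore e k [:: x] [:: x])) ys.

(** The number k of rounds is a parameter because this direction holds for every
    k: too few rounds make a check fail, and never make it succeed wrongly. *)
Lemma explore_ind (P : nat -> Prop) e k seen new :
  (forall i j, P i -> j \in e i -> P j) ->
  {in seen, forall i, P i} -> {subset new <= seen} ->
  {in explore e k seen new, forall i, P i}.
Proof.
move=> Pe; elim: k seen new => [|k IH] seen new //= Pseen sub.
apply: IH => [j|j]; last by rewrite mem_cat => ->.
rewrite mem_cat mem_undup mem_filter => /orP[/andP[_]|/Pseen //].
by case/flatten_mapP => i /sub/Pseen Pi; apply: Pe.
Qed.

Lemma reach_connect (r : rel 'I_n) e k (x y : 'I_n) :
  (forall (u : 'I_n) j, j \in e u -> exists2 v : 'I_n, v = j :> nat & r u v) ->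
  (y : nat) \in explore e k [:: x : nat] [:: x : nat] -> connect r x y.
Proof.
move=> er yx.
have [v /val_inj <- //] : exists2 v : 'I_n, v = y :> nat & connect r x v.
apply: (explore_ind (P := fun i => exists2 v : 'I_n, v = i :> nat & connect r x v)) yx => //.
  move=> _ j [u <- xu] /er[v vj uv]; exists v => //.
  exact: connect_trans xu (connect1 uv).
by move=> i; rewrite inE => /eqP ->; exists x; rewrite ?connect0.
Qed.

Lemma connected_from (T : finType) (r : rel T) (A : {set T}) x :
  symmetric r -> x \in A ->
  (forall y, y \in A ->
     connect (fun u v => [&& u \in A, v \in A & r u v]) x y) ->
  connected_in r A.
Proof.
move=> rS xA cx; apply/forall_inP => y yA; apply/forall_inP => z zA.
apply: connect_trans (cx z zA); rewrite sym_connect_sym ?cx // => u v.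
by rewrite rS andbCA.
Qed.
End Reach.

Section Connectivity.
Variables (m : nat) (L : seq (seq nat)).
Hypothesis cub : cubic_lists m L.
Let n := m.+1.
Let G := lgraph m L.
Let nb i := nth [::] L i.

Definition nb_avoiding (S : seq nat) (i : nat) : seq nat :=
  if i \in S then [::] else [seq j <- nb i | j \notin S].

Definition connected_avoiding k (S : seq nat) : bool :=
  let ys := [seq i <- iota 0 n | i \notin S] in
  reaches_all (nb_avoiding S) k (head 0 ys) ys.

Lemma connected_avoidingP k (S : seq nat) (B : {set G}) :
  (forall u : G, (u \in B) = (val u \in S)) ->
  connected_avoiding k S -> connected_in (@adj G) (~: B).
Proof.
move=> BS /allP ok; case: (set_0Vmem (~: B)) => [->|[x0 x0B]].
  by apply/forall_inP => x; rewrite in_set0.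
pose ys := [seq i <- iota 0 n | i \notin S].
have ysP (y : G) : (val y \in ys) = (y \in ~: B).
  by rewrite mem_filter mem_iota /= add0n ltn_ord andbT [RHS]in_setC BS.
have hys : head 0 ys \in ys.
  by case: (ys) ysP => [/(_ x0)|i s _]; [rewrite x0B | exact: mem_head].
have lth : head 0 ys < n by move: hys; rewrite mem_filter mem_iota => /andP[].
apply: (connected_from (x := Ordinal lth : G)).
- exact: adj_sym.
- by rewrite -ysP.
move=> y; rewrite -ysP => /ok.
move=> reach; apply: (@reach_connect m _ (nb_avoiding S) k (Ordinal lth) y _ reach) => u j; rewrite /nb_avoiding; case: ifP => // uS.
rewrite mem_filter => /andP[jS ju].
have [_ _ /(_ j ju)[ltj _ _]] := cubicP cub (ltn_ord u).
exists (Ordinal ltj) => //.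
by rewrite ![_ \in ~: _]inE !BS uS jS /= -[link _ _ _]/(@adj G u (Ordinal ltj)) (adjE cub).
Qed.

Lemma lgraph_connected k : connected_avoiding k [::] -> is_connected G.
Proof.
move=> ok; rewrite /is_connected -setC0; apply: connected_avoidingP ok.
by move=> u; rewrite !inE.
Qed.

Definition connected3 k : bool :=
  all (fun a => all (fun b => connected_avoiding k [:: a; b]) (iota 0 n)) (iota 0 n).

Lemma isolated_not_connected (T : finType) (r : rel T) (A : {set T}) x y :
  x \in A -> y \in A -> x != y -> (forall z, z \in A -> ~~ r x z) ->
  ~~ connected_in r A.
Proof.
move=> xA yA xy iso; apply/negP => /forall_inP/(_ x xA)/forall_inP/(_ y yA).
case/connectP => [[|z p]] /=; first by move=> _ yx; rewrite yx eqxx in xy.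
by case/andP => /and3P[_ zA xz]; move: (iso z zA); rewrite xz.
Qed.

(** The three neighbours of a vertex form a cut, and all smaller sets are
    checked; the pair (a, a) stands for a single vertex. *)
Lemma vertex_connectivity3 k :
  5 <= n -> connected_avoiding k [::] -> connected3 k ->
  vertex_connectivity G = 3.
Proof.
move=> le5 ok0 /allP ok; apply: bigminn_eq.
- by rewrite card_ord; apply: leq_trans le5.
- exists (nbh (ord0 : G)); last exact: (lgraph_cubic cub).
  apply/orP; left.
  have [y] : exists y : G, y \notin ord0 |: nbh (ord0 : G).
    apply/existsP; rewrite -negb_forall; apply/negP => /forallP all.
    have : #|G| <= #|ord0 |: nbh (ord0 : G)|.
      by rewrite -cardsT subset_leq_card //; apply/subsetP => y _; apply: all.
    rewrite cardsU1 (lgraph_cubic cub) inE adj_irrefl card_ord /=.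
    by rewrite leqNgt le5.
  rewrite !inE negb_or => /andP[y0 yN].
  apply: (isolated_not_connected (x := ord0 : G) (y := y)).
  - by rewrite !inE adj_irrefl.
  - by rewrite !inE.
  - by rewrite eq_sym.
  by move=> z; rewrite !inE.
move=> S /orP[|]; last first.
  move=> le1; have := cardsC S; rewrite card_ord => E.
  rewrite -(leq_add2r #|~: S|) E; apply: leq_trans (leq_add (leqnn 3) le1) _.
  exact: leq_trans le5.
rewrite leqNgt; apply: contra => ltS.
have pair (a b : G) : S = [set a; b] -> connected_in (@adj G) (~: S).
  move=> E; apply: (@connected_avoidingP k [:: val a; val b]).
    by move=> u; rewrite E !inE.
  by move/(_ (val a)): ok; rewrite mem_iota ltn_ord => /(_ isT)/allP; apply; rewrite mem_iota ltn_ord.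
move: ltS; rewrite ltnS leq_eqVlt => /orP[/cards2P[a [b [_ E]]]|].
  exact: pair E.
rewrite ltnS leq_eqVlt => /orP[/cards1P[a E]|].
  by apply: (pair a a); rewrite E setUid.
rewrite ltnS leqn0 cards_eq0 => /eqP ->.
by apply: connected_avoidingP ok0 => u; rewrite !inE.
Qed.

End Connectivity.

(** * Edges and edge connectivity *)

Section EdgeList.
Variables (m : nat) (L : seq (seq nat)).
Let n := m.+1.
Let G := lgraph m L.
Let nb i := nth [::] L i.

Definition edge_list : seq (nat * nat) :=
  flatten [seq [seq (i, j) | j <- nb i & i < j] | i <- iota 0 n].

Definition edge_of (p : nat * nat) : {set G} := [set (inord p.1 : 'I_n); inord p.2].

Definition ordered (i j : nat) : nat * nat := (minn i j, maxn i j).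

Lemma edge_of_ordered (u v : G) : edge_of (ordered u v) = [set u; v].
Proof.
rewrite /edge_of /ordered /=; case: (leqP (u : nat) v) => _; rewrite !inord_val //.
exact: setUC.
Qed.

Lemma set2_ordered (u v u' v' : G) :
  [set u; v] = [set u'; v'] -> ordered u v = ordered u' v'.
Proof.
move=> E; have : u \in [set u'; v'] by rewrite -E set21.
have : v \in [set u'; v'] by rewrite -E set22.
have : u' \in [set u; v] by rewrite E set21.
have : v' \in [set u; v] by rewrite E set22.
rewrite !inE /ordered => /orP[]/eqP-> /orP[]/eqP-> //.
- by move=> /orP[]/eqP->.
- by rewrite minnC maxnC.
- by move=> _ /orP[]/eqP->.
Qed.

Hypothesis cub : cubic_lists m L.

Lemma mem_edge_list i j :
  ((i, j) \in edge_list) = [&& i < n, j \in nb i & i < j].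
Proof.
apply/flatten_mapP/and3P => [[i']|[lti jn ij]].
  rewrite mem_iota => /andP[_ lti] /mapP[j']; rewrite mem_filter.
  by move=> /andP[ij jn] [-> ->].
by exists i; rewrite ?mem_iota //; apply/mapP; exists j; rewrite // mem_filter ij.
Qed.

Lemma edge_list_lt p : p \in edge_list -> p.1 < n /\ p.2 < n.
Proof.
case: p => i j; rewrite mem_edge_list => /and3P[lti jn _].
by have [_ _ /(_ j jn)[]] := cubicP cub lti.
Qed.

Lemma edge_of_inj : {in edge_list &, injective edge_of}.
Proof.
move=> [i j] [i' j'] ein ein' /set2_ordered; rewrite /ordered.
have [/= lti ltj] := edge_list_lt ein; have [/= lti' ltj'] := edge_list_lt ein'.
move: ein ein'; rewrite !mem_edge_list !inordK // => /and3P[_ _ ij] /and3P[_ _ ij'].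
by rewrite (minn_idPl (ltnW ij)) (minn_idPl (ltnW ij')) (maxn_idPr (ltnW ij)) (maxn_idPr (ltnW ij')).
Qed.

Lemma ordered_edge_list (u v : G) : (ordered u v \in edge_list) = adj u v.
Proof.
rewrite /ordered; case: (ltngtP (u : nat) v) => [uv|vu|/val_inj ->].
- by rewrite (adjE cub) mem_edge_list uv andbT ltn_ord.
- by rewrite adj_sym (adjE cub) mem_edge_list vu andbT ltn_ord.
by rewrite mem_edge_list ltnn !andbF adj_irrefl.
Qed.

Lemma mem_edges_ordered (u v : G) : ([set u; v] \in edges G) = adj u v.
Proof.
apply/imsetP/idP => [[[u' v']]|uv]; last by exists (u, v); rewrite // inE.
rewrite [_ \in darts G]inE => uv /set2_ordered E.
by rewrite -ordered_edge_list E ordered_edge_list.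
Qed.

Lemma edges_of : edges G =i map edge_of edge_list.
Proof.
move=> e; apply/imsetP/mapP => [[[u v]]|[[i j] ein ->]].
  rewrite [_ \in darts G]inE => uv ->; exists (ordered u v).
    by rewrite ordered_edge_list.
  by rewrite edge_of_ordered.
have [/= lti ltj] := edge_list_lt ein.
exists (inord i, inord j) => //; rewrite [_ \in darts G]inE (adjE cub) /= !inordK //.
by move: ein; rewrite mem_edge_list => /and3P[].
Qed.

Lemma edge_list_uniq : uniq edge_list.
Proof.
apply: allpairs_uniq_dep => [||[i j] [i' j'] _ _ /= [-> ->]] //.
  exact: iota_uniq.
by move=> i _; rewrite filter_uniq // (nb_uniq cub).
Qed.

Lemma lgraph_size : graph_size G = size edge_list.
Proof.
rewrite /graph_size (eq_card edges_of) -(size_map edge_of edge_list).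
apply/card_uniqP; rewrite map_inj_in_uniq ?edge_list_uniq //; apply: edge_of_inj.
Qed.

Definition nb_cutting (p q : nat * nat) (i : nat) : seq nat :=
  [seq j <- nb i | ordered i j \notin [:: p; q]].

Definition edge_connected3 k : bool :=
  all (fun p => all (fun q => reaches_all (nb_cutting p q) k 0 (iota 0 n))
    edge_list) edge_list.

(** The three edges at a vertex form a cut.  Sets of at most two edges are
    contained in a pair, and the graph without that pair is checked to be
    connected. *)
Lemma edge_connectivity3 k :
  2 < size edge_list -> edge_connected3 k -> edge_connectivity G = 3.
Proof.
move=> lt2 /allP ok; apply: bigminn_eq.
- by rewrite -/(graph_size G) lgraph_size.
- pose v0 : G := (ord0 : 'I_n).
  exists [set [set v0; u] | u in nbh v0]; last first.
    rewrite card_in_imset ?(lgraph_cubic cub) // => u u'; rewrite !inE => uv _ E.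
    have : u \in [set v0; u'] by rewrite -E set22.
    by rewrite !inE => /orP[/eqP E0|/eqP//]; rewrite E0 adj_irrefl in uv.
  apply/andP; split.
    by apply/subsetP => _ /imsetP[u + ->]; rewrite inE mem_edges_ordered.
  have [u] : exists u, u \in nbh v0.
    by apply/set0Pn; rewrite -card_gt0 (lgraph_cubic cub).
  rewrite inE => v0u; apply: (isolated_not_connected (x := v0) (y := u)).
  - by rewrite inE.
  - by rewrite inE.
  - by apply: contraTneq v0u => ->; rewrite adj_irrefl.
  move=> z _; rewrite /span_rel inE mem_edges_ordered andbC; apply/negP => /andP[v0z].
  by case/imsetP; exists z; rewrite ?inE.
move=> F /andP[/subsetP sub]; rewrite leqNgt; apply: contra => ltF.
have pair (e1 e2 : {set G}) : e1 \in edges G -> e2 \in edges G ->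
    F \subset [set e1; e2] -> connected_in (span_rel (edges G :\: F)) [set: G].
  rewrite !edges_of => /mapP[p pin ->] /mapP[q qin ->] /subsetP F12.
  have /allP/(_ q qin)/allP reach := ok p pin.
  have sS : symmetric (span_rel (edges G :\: F)).
    by move=> u v; rewrite /span_rel setUC.
  (* Even the graph without both edges of the pair is connected. *)
  apply: (connected_from (x := (ord0 : 'I_n) : G) sS) => [|y _]; first by rewrite inE.
  have := reach (val y); rewrite mem_iota ltn_ord => /(_ isT) {}reach.
  apply: (@reach_connect m _ (nb_cutting p q) k ord0 y _ reach) => u j.
  rewrite mem_filter => /andP[ej ju].
  have [_ _ /(_ j ju)[ltj _ _]] := cubicP cub (ltn_ord u).
  exists (Ordinal ltj) => //.
  have uv : @adj G u (Ordinal ltj) by rewrite (adjE cub).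
  rewrite ![_ \in [set: _]]inE /= /span_rel in_setD mem_edges_ordered uv andbT.
  apply: contra ej => /F12; rewrite !inE => /orP[]/eqP E.
    rewrite (edge_of_inj (x := ordered u j) (y := p)) ?eqxx ?ordered_edge_list //.
      by rewrite -[j]/(val (Ordinal ltj)) ordered_edge_list.
    by rewrite -E -[j]/(val (Ordinal ltj)) edge_of_ordered.
  rewrite (edge_of_inj (x := ordered u j) (y := q)) ?eqxx ?orbT //.
    by rewrite -[j]/(val (Ordinal ltj)) ordered_edge_list.
  by rewrite -E -[j]/(val (Ordinal ltj)) edge_of_ordered.
move: ltF; rewrite ltnS leq_eqVlt => /orP[/cards2P[a [b [_ E]]]|].
  by apply: (pair a b); rewrite -?E ?subxx //; apply: sub; rewrite E ?set21 ?set22.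
rewrite ltnS leq_eqVlt => /orP[/cards1P[a E]|].
  have aE : a \in edges G by apply: sub; rewrite E set11.
  by apply: (pair a a); rewrite // E setUid.
rewrite ltnS leqn0 cards_eq0 => /eqP F0.
have [e eE] : exists e, e \in edges G.
  by apply/set0Pn; rewrite -card_gt0 -/(graph_size G) lgraph_size; apply: leq_trans lt2.
by apply: (pair e e); rewrite // F0 sub0set.
Qed.

End EdgeList.

(** * Distances *)

Section Distances.
Variables (m : nat) (L : seq (seq nat)).
Hypothesis cub : cubic_lists m L.
Let n := m.+1.
Let G := lgraph m L.
Let nb i := nth [::] L i.

(** The distance is the least length of a walk, so the sets of end points of
    walks of exact length k suffice. *)
Definition walk_ends (x k : nat) : seq nat :=
  iter k (fun s => undup (flatten [seq nb i | i <- s])) [:: x].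

Lemma walk_endsP (x y : G) k :
  reflect (exists p, [/\ size p = k, path (@adj G) x p & last x p = y])
    (val y \in walk_ends (val x) k).
Proof.
elim: k y => [|k IH] y.
  rewrite inE; apply: (iffP eqP) => [/val_inj->|[p [/size0nil -> _ <-]] //].
  by exists [::].
rewrite /walk_ends /= mem_undup.
apply: (iffP flatten_mapP) => [[z zk yz]|[p []]].
  have ltz : z < n.
    have [//|lez] := ltnP z n; move: yz; rewrite /nb nth_default //.
    by case/andP: cub => /eqP ->.
  have /IH[p [sp pp lp]] : val (Ordinal ltz : G) \in walk_ends (val x) k by [].
  exists (rcons p y); rewrite size_rcons sp rcons_path last_rcons pp lp.
  by rewrite (linkE cub).

case/lastP: p => // p z; rewrite size_rcons rcons_path last_rcons.
move=> [sp] /andP[pp zl] <-; exists (val (last x p)); last by rewrite -(linkE cub) ?ltn_ord.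
by apply/IH; exists p.
Qed.

Definition distance (x y : nat) : nat :=
  find (fun k => y \in walk_ends x k) (iota 0 n).

Lemma dist_distance (x y : G) : dist x y = distance (val x) (val y).
Proof.
rewrite /dist /distance card_ord; apply: eq_find => k.
apply/existsP/walk_endsP => [[p /andP[pp /eqP lp]]|[p [sp pp lp]]].
  by exists p; rewrite size_tuple.
have sp' : size p == k by apply/eqP.
by exists (Tuple sp'); rewrite pp lp eqxx.
Qed.

Definition ecc (x : nat) : nat := foldr (fun y => maxn (distance x y)) 0 (iota 0 n).

Lemma eccentricity_ecc (x : G) : eccentricity x = ecc (val x).
Proof.
rewrite /eccentricity /ecc -(bigmax_ord n (distance (val x))).
by apply: eq_bigr => y _; rewrite dist_distance.
Qed.

Lemma diameter_ecc : diameter G = foldr (fun x => maxn (ecc x)) 0 (iota 0 n).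
Proof.
by rewrite -bigmax_ord; apply: eq_bigr => x _; apply: eccentricity_ecc.
Qed.

Lemma radius_ecc : radius G = foldr (fun x => minn (ecc x)) n (iota 0 n).
Proof.
rewrite /radius card_ord -(bigmin_ord n n ecc).
by apply: eq_bigr => x _; apply: eccentricity_ecc.
Qed.

End Distances.

(** * Forests and connectivity *)

Section Forests.
Variable G : sgraph.
Implicit Types (F : {set {set G}}) (u v x y : G).

Definition acyclic F : bool :=
  [forall k : 'I_#|G|.+1, ~~ has_cycle (span_rel F) k].

Lemma acyclicP F :
  reflect (forall c : seq G, 2 < size c -> ~ ucycle (span_rel F) c) (acyclic F).
Proof.
apply: (iffP forallP) => [acyc c lt2 uc|acyc k].
  have lec : size c < #|G|.+1.
    by rewrite ltnS -(card_uniqP (proj2 (andP uc))) max_card.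
  have /negP[] := acyc (Ordinal lec); rewrite /has_cycle lt2; apply/existsP.
  by exists (in_tuple c).
apply/negP => /andP[lt2 /existsP[c uc]].
by apply: (acyc c) uc; rewrite size_tuple.
Qed.

Lemma span_rel_sym F : symmetric (span_rel F).
Proof. by move=> x y; rewrite /span_rel setUC. Qed.

Lemma connect_span_sym F : connect_sym (span_rel F).
Proof. exact/sym_connect_sym/span_rel_sym. Qed.

Lemma acyclic_sub F F' : F \subset F' -> acyclic F' -> acyclic F.
Proof.
move=> /subsetP sub /acyclicP acyc; apply/acyclicP => c lt2 /andP[cyc uc].
apply: (acyc c lt2); rewrite /ucycle uc andbT.
by apply: sub_cycle cyc => x y /sub.
Qed.

Lemma path_sub_belast (T : eqType) (e e' : rel T) (z : T) q :
  (forall a b : T, a \in belast z q -> e a b -> e' a b) -> path e z q -> path e' z q.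
Proof.
elim: q z => //= y q IH z sub /andP[zy yq].
rewrite sub ?mem_head //=; apply: IH yq => a b ain; apply: sub.
by rewrite inE ain orbT.
Qed.

(** Rotated so as to start with u, v, the cycle returns from v to u without
    using the edge uv again, because its vertices are distinct and there are at
    least three of them. *)
Lemma cycle_through u v F c :
  2 < size c -> ucycle (span_rel ([set u; v] |: F)) c -> u \in c ->
  next c u = v -> connect (span_rel F) v u.
Proof.
move=> lt2 /andP[cyc uc] uin; have [i p Ec] := rot_to uin.
have up : uniq (u :: p) by rewrite -Ec rot_uniq.
have cp : path.cycle (span_rel ([set u; v] |: F)) (u :: p) by rewrite -Ec rot_cycle.
have sp : 2 < size (u :: p) by rewrite -Ec size_rot.
rewrite -(next_rot i uc) Ec.
case: p {Ec} up cp sp => [|w [|x p]] // up cp _.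
rewrite [next _ _]/= eqxx => wv; subst w.
have /and3P[_ vx xp] := cp; move: up; rewrite /= !inE !negb_or.
move=> /and3P[/and3P[uv ux uNp] /andP[vx' vNp] _].
have inF a b : a != u -> a != v -> span_rel ([set u; v] |: F) a b -> span_rel F a b.
  move=> au av; rewrite /span_rel !inE => /orP[/eqP E|//].
  by have := set21 a b; rewrite E !inE (negPf au) (negPf av).
have vxF : span_rel F v x.
  by rewrite span_rel_sym; apply: inF; rewrite 1?span_rel_sym // eq_sym.
apply: connect_trans (connect1 vxF) _; apply/connectP.
exists (rcons p u); last by rewrite last_rcons.
apply: path_sub_belast xp => a b; rewrite belast_rcons => ain; apply: inF.
  by apply: contraTneq ain => ->; rewrite inE negb_or ux uNp.
by apply: contraTneq ain => ->; rewrite inE negb_or vx' vNp.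
Qed.

(** The principle behind counting spanning trees by inserting edges: an edge
    creates a cycle exactly if its ends are already connected. *)
Lemma acyclic_add u v F :
  u != v -> [set u; v] \notin F -> acyclic F ->
  acyclic ([set u; v] |: F) = ~~ connect (span_rel F) u v.
Proof.
move=> uv uvF acycF; apply/idP/idP.
  move=> /acyclicP acyc; apply/negP => /connectP[p pp lp].
  case/shortenP: pp lp => q pq uq _ {p} vq.
  apply: (acyc (u :: q)).
    case: q pq vq {uq} => [|w [|x q]] //=; first by move=> _ vu; rewrite vu eqxx in uv.
    by rewrite andbT => uw vw; rewrite -vw in uw; rewrite /span_rel (negPf uvF) in uw.
  rewrite /ucycle uq andbT /= rcons_path -vq; apply/andP; split.
    by apply: sub_path pq => a b; apply: setU1r.
  by rewrite /span_rel setUC setU11.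
move=> nc; apply/acyclicP => c lt2 uc; case/acyclicP/(_ c lt2): acycF.
have /andP[cyc unc] := uc; rewrite /ucycle unc andbT.
(* An edge of the cycle outside F is uv, run through in one of two directions. *)
apply: cycle_from_next => // x xc.
have := next_cycle cyc xc; rewrite /span_rel !inE => /orP[/eqP E|//].
case/negP: nc; have := set21 x (next c x); rewrite E !inE => /orP[]/eqP xE.
  rewrite connect_span_sym; apply: (cycle_through lt2 uc); rewrite -xE //.
  have := set22 x (next c x); rewrite E !inE -xE => /orP[]/eqP // nx.
  by have := set22 u v; rewrite -E nx setUid inE xE eq_sym (negPf uv).
rewrite (setUC [set u]) in uc; apply: (cycle_through lt2 uc); rewrite -xE //.
have := set22 x (next c x); rewrite E !inE -xE => /orP[]/eqP // nx.
by have := set21 u v; rewrite -E nx setUid inE xE (negPf uv).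
Qed.

Lemma connect_labels (l : G -> nat) u v F :
  (forall x y, (l x == l y) = connect (span_rel F) x y) ->
  let l' x := if l x == l v then l u else l x in
  forall x y, (l' x == l' y) = connect (span_rel ([set u; v] |: F)) x y.
Proof.
move=> lF l' x y.
have subF a b : connect (span_rel F) a b -> connect (span_rel ([set u; v] |: F)) a b.
  by apply: connect_sub => {}a {}b ab; apply/connect1/setU1r.
have uv : connect (span_rel ([set u; v] |: F)) u v.
  by apply/connect1; rewrite /span_rel setU11.
apply/idP/idP; last first.
  case/connectP => p pp ->; elim: p x pp => //= z p IH x /andP[xz /IH /eqP <-].
  move: xz; rewrite /span_rel !inE => /orP[/eqP E|xz]; last first.
    by have /eqP E : l x == l z by [rewrite lF connect1]; rewrite /l' E.
  have l'uv : l' u = l' v by rewrite /l' eqxx; case: eqP.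
  have := set21 x z; have := set22 x z; rewrite E !inE.
  by move=> /orP[]/eqP-> /orP[]/eqP->; rewrite ?l'uv.
rewrite /l'; case: ifP => xv; case: ifP => yv; rewrite ?lF => xy.
- by rewrite lF in xv; rewrite eq_sym lF in yv; apply: connect_trans (subF _ _ xv) (subF _ _ yv).
- rewrite lF in xv; apply: connect_trans (subF _ _ xv) _.
  rewrite connect_span_sym in uv; apply: connect_trans uv _; exact: subF.
- rewrite eq_sym lF in yv; apply: connect_trans (subF _ _ xy) _.
  by apply: connect_trans uv (subF _ _ yv).
exact: subF.
Qed.

End Forests.

(** * Counting spanning trees by deletion and contraction *)

Lemma constant_mapP (T : eqType) (l : T -> nat) (r : seq T) :
  reflect {in r &, forall x y, l x = l y} (constant (map l r)).
Proof.
case: r => [|z r] /=; first by constructor.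
rewrite all_map; apply: (iffP allP) => [cst x y|cst x xr].
  rewrite !inE => /predU1P[->|/cst/eqP ->] /predU1P[->//|/cst/eqP ->] //.
by apply/eqP/cst; rewrite inE ?xr ?eqxx ?orbT.
Qed.

Section TreesBetween.
Variable G : sgraph.
Implicit Types (F A : {set {set G}}).

(** The number of spanning trees of the graph with edge set F or A that contain
    F; for A including e it obeys the deletion-contraction recursion below. *)
Definition trees_between F A : nat :=
  #|[set F' : {set {set G}} | [&& F \subset F', F' \subset F :|: A, acyclic F' &
                 connected_in (span_rel F') [set: G]]]|.

Lemma trees_between_cyclic F A : ~~ acyclic F -> trees_between F A = 0.
Proof.
move=> cycF; apply/eqP; rewrite cards_eq0; apply/eqP/setP => F'; rewrite !inE.
by apply/negP => /and4P[sub _ acyc _]; rewrite (acyclic_sub sub acyc) in cycF.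
Qed.

Lemma trees_between_add F A e : e \notin F -> e \notin A ->
  trees_between F (e |: A) = trees_between F A + trees_between (e |: F) A.
Proof.
move=> eF eA; rewrite /trees_between -(cardsID [set F' : {set {set G}} | e \in F']) addnC.
congr (_ + _); apply: eq_card => F'; rewrite !inE.
  case: (boolP (e \in F')) => eF' /=.
    apply/esym/negP => /and4P[_ /subsetP/(_ e eF') + _ _].
    by rewrite inE (negPf eF) (negPf eA).
  congr [&& _, _ & _]; apply/subsetP/subsetP => sub x xF'; have := sub x xF'.
    by rewrite !inE; case: eqP => // E; rewrite -E xF' in eF'.
  by rewrite !inE => /orP[]->; rewrite ?orbT.
rewrite subUset sub1set; case: (e \in F'); rewrite ?andbF //= andbT.
by rewrite [_ |: F]setUC -setUA.
Qed.

Lemma trees_between0 F (l : G -> nat) (r : seq G) :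
  acyclic F -> (forall x, x \in r) ->
  (forall x y, (l x == l y) = connect (span_rel F) x y) ->
  trees_between F set0 = constant (map l r).
Proof.
move=> acycF memr lF.
have conn : connected_in (span_rel F) [set: G] = constant (map l r).
  have connE x y : connect (fun u v => [&& u \in [set: G], v \in [set: G] & span_rel F u v]) x y =
     (l x == l y).
    by rewrite lF; apply: eq_connect => u v; rewrite !inE.
  apply/forall_inP/constant_mapP => [cF x y _ _|cst x _].
    by apply/eqP; have /forall_inP/(_ y (in_setT y)) := cF x (in_setT x); rewrite connE.
  by apply/forall_inP => y _; rewrite connE; apply/eqP/cst.
rewrite /trees_between setU0 -conn.
rewrite (_ : [set _ | _] = if connected_in (span_rel F) setT then [set F] else set0).
  by case: ifP; rewrite ?cards1 ?cards0.
apply/setP => F'; rewrite inE andbA -eqEsubset eq_sym.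
by case: ifP => cF; rewrite !inE; case: eqP => //= ->; rewrite acycF ?cF.
Qed.

End TreesBetween.

Section TreeRecursion.
Implicit Types (V : seq nat) (l : nat -> nat) (es : seq (nat * nat)).

Definition merge l u v x : nat := if l x == l v then l u else l x.

(** Deletion and contraction on labelled vertices: equal labels mean connected
    by the edges chosen so far. *)
Fixpoint trees V l es : nat :=
  if es is (u, v) :: es' then
    trees V l es' + (if l u == l v then 0 else trees V (merge l u v) es')
  else constant (map l V).

Definition ends es : seq nat := flatten [seq [:: e.1; e.2] | e <- es].

Lemma eq_merge l l' V u v : u \in V -> v \in V ->
  {in V &, forall x y, (l x == l y) = (l' x == l' y)} ->
  {in V &, forall x y, (merge l u v x == merge l u v y) =
                       (merge l' u v x == merge l' u v y)}.
Proof.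
move=> uV vV ll' x y xV yV; rewrite /merge -!ll' //.
by case: ifP; case: ifP => *; rewrite ?ll' ?eqxx.
Qed.

Lemma eq_trees V l l' es : {subset ends es <= V} ->
  {in V &, forall x y, (l x == l y) = (l' x == l' y)} ->
  trees V l es = trees V l' es.
Proof.
elim: es l l' => [|[u v] es IH] l l' sub ll' /=.
  congr nat_of_bool; apply/constant_mapP/constant_mapP => cst x y xV yV; apply/eqP.
    by rewrite -ll' // (cst x y).
  by rewrite ll' // (cst x y).
have [uV vV] : u \in V /\ v \in V by split; apply: sub; rewrite !inE eqxx ?orbT.
have {}sub : {subset ends es <= V} by move=> x xin; apply: sub; rewrite !inE xin !orbT.
rewrite (IH l l') // (IH (merge l u v) (merge l' u v)) //; last exact: eq_merge.
by rewrite ll'.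
Qed.

(** A vertex with no edge left to decide is redundant once another vertex
    carries its label. *)
Lemma trees_drop V l es x y : uniq V -> x \notin ends es ->
  y \in V -> y != x -> l y = l x ->
  trees V l es = trees [seq z <- V | z != x] l es.
Proof.
move=> uV + yV yx; elim: es l => [|[u v] es IH] l /= xes lyx.
  congr nat_of_bool; apply/constant_mapP/constant_mapP => cst a b.
    by rewrite !mem_filter => /andP[_ aV] /andP[_ bV]; apply: cst.
  have red c : c \in V -> exists2 d, d \in [seq z <- V | z != x] & l c = l d.
    move=> cV; have [cx|cx] := eqVneq c x; last by exists c; rewrite // mem_filter cx.
    by exists y; rewrite ?mem_filter ?yx // cx.
  by move=> /red[a' a'V ->] /red[b' b'V ->]; apply: cst.
move: xes; rewrite !inE !negb_or => /and3P[xu xv xes].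
by rewrite IH // IH // /merge lyx.
Qed.

(** Conversely, if nothing shares its label although other vertices remain, its
    component is cut off for good. *)
Lemma trees_dead V l es x y : x \notin ends es -> x \in V -> y \in V -> y != x ->
  {in V, forall z, z != x -> l z != l x} -> {subset ends es <= V} ->
  trees V l es = 0.
Proof.
move=> + xV yV yx; elim: es l => [|[u v] es IH] l /= xes alone sub.
  apply/eqP; rewrite eqb0; apply/negP => /constant_mapP/(_ y x yV xV).
  by apply/eqP/alone.
move: xes; rewrite !inE !negb_or => /and3P[xu xv xes].
have [uV vV] : u \in V /\ v \in V by split; apply: sub; rewrite !inE eqxx ?orbT.
have {}sub : {subset ends es <= V} by move=> z zin; apply: sub; rewrite !inE zin !orbT.
rewrite IH // IH ?if_same // => z zV zx; rewrite /merge.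
have [ux vx] : l u != l x /\ l v != l x by split; apply: alone; rewrite // eq_sym.
rewrite [l x == l v]eq_sym (negPf vx); case: ifP => // _; exact: alone.
Qed.

End TreeRecursion.

(** * Spanning trees, edge by edge *)

Section TreeCount.
Variables (m : nat) (L : seq (seq nat)).
Hypothesis cub : cubic_lists m L.
Let n := m.+1.
Let G := lgraph m L.

Lemma trees_between_labels es (F : {set {set G}}) (l : nat -> nat) :
  {subset es <= edge_list m L} -> uniq es -> acyclic F ->
  {in es, forall p, edge_of m L p \notin F} ->
  (forall x y : G, (l (val x) == l (val y)) = connect (span_rel F) x y) ->
  trees (iota 0 n) l es = trees_between F [set e in map (@edge_of m L) es].
Proof.
rewrite -(val_enum_ord n); elim: es F l => [|[u v] es IH] F l /= sub ues acycF esF lF.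
  rewrite (_ : [set e in [::]] = set0); last by apply/setP => e; rewrite !inE.
  rewrite (trees_between0 (l := fun x : G => l (val x)) (r := enum 'I_n) acycF) //.
    by rewrite -map_comp.
  by move=> x; rewrite mem_enum.
have [pNes {}ues] := andP ues.
have pE : (u, v) \in edge_list m L by apply: sub; apply: mem_head.
have [/= ltu ltv] := edge_list_lt cub pE.
have uv : u < v by move: pE; rewrite mem_edge_list => /and3P[].
set e := edge_of m L (u, v).
have eF : e \notin F by apply: esF; apply: mem_head.
have eNes : e \notin [set e in map (@edge_of m L) es].
  rewrite inE; apply/mapP => -[q qes] /(edge_of_inj cub) E.
  by rewrite E ?qes // in pNes; apply: sub; rewrite inE qes orbT.
(* From here on, the recursion of [trees_between_add] on the first edge. *)
have {}sub : {subset es <= edge_list m L} by move=> q qes; apply: sub; rewrite inE qes orbT.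
have -> : [set e' in e :: map (@edge_of m L) es] = e |: [set e in map (@edge_of m L) es].
  by apply/setP => e'; rewrite !inE.
rewrite trees_between_add // (IH F l) //; last first.
  by move=> q qes; apply: esF; rewrite inE qes orbT.
congr (_ + _).
pose u' : G := inord u : 'I_n; pose v' : G := inord v : 'I_n.
have vu' : val u' = u by rewrite /= inordK.
have vv' : val v' = v by rewrite /= inordK.
have uv' : u' != v' by apply/eqP => /(congr1 val); rewrite vu' vv' => E; rewrite E ltnn in uv.
have luv : (l u == l v) = connect (span_rel F) u' v' by rewrite -lF vu' vv'.
have acyc := acyclic_add uv' eF acycF.
rewrite luv; case: ifP acyc => [_ acyc|_ acyc].
  by rewrite trees_between_cyclic // [e |: F]/([set u'; v'] |: F) acyc.
apply: IH => // [q qes|x y].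
  rewrite !inE negb_or esF ?andbT; last by rewrite inE qes orbT.
  apply: contraNneq eNes => <-; rewrite inE; exact: map_f.
rewrite -[e |: F]/([set u'; v'] |: F) -(connect_labels u' v' (l := fun x : G => l (val x))) //=.
by rewrite /merge !inordK.
Qed.

Lemma spanning_tree_count_trees es :
  perm_eq es (edge_list m L) ->
  spanning_tree_count G = trees (iota 0 n) id es.
Proof.
move=> esP.
have acyc0 : acyclic (set0 : {set {set G}}).
  by apply/acyclicP => -[|x [|y c]] //= _ /andP[/= /andP[]]; rewrite /span_rel inE.
rewrite (@trees_between_labels es set0 id) //.
- have edgesE : edges G = [set e in map (@edge_of m L) es].
    apply/setP => e; rewrite (edges_of cub) inE.
    by apply/mapP/mapP => -[p pes ->]; exists p;
      rewrite ?(perm_mem esP) // -(perm_mem esP).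
  rewrite /spanning_tree_count /trees_between; congr #|pred_of_set _|.
  apply/setP => F; rewrite !inE sub0set set0U /spanning_tree -/(acyclic F).
  by rewrite edgesE [X in _ && X]andbC.
- by move=> p; rewrite (perm_mem esP).
- by rewrite (perm_uniq esP) (edge_list_uniq cub).
- by move=> p _; rewrite inE.
move=> x y; apply/eqP/connectP => [/val_inj->|[[|z p]] /=]; first by exists [::].
  by move=> _ ->.
by rewrite /span_rel inE.
Qed.

End TreeCount.

Section TreeStates.
Definition tree_state := seq (nat * nat).
Implicit Types (st : seq (nat * nat)) (es : seq (nat * nat)).

Fixpoint lookup st (x : nat) : nat :=
  if st is (y, a) :: st' then if x == y then a else lookup st' x else 0.

Definition relabel (f : nat -> nat) st : seq (nat * nat) :=
  [seq (x.1, f x.2) | x <- st].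

Definition merge_state u v st :=
  let a := lookup st u in let b := lookup st v in
  relabel (fun c => if c == b then a else c) st.

(** Labels matter only up to renaming; the index of first occurrence is a
    canonical choice, which makes equivalent states equal. *)
Definition normalise st :=
  let labels := map snd st in relabel (fun c => index c labels) st.

(** The two pruning rules; a lone vertex of a one-vertex state is a finished
    tree and must be kept. *)
Definition retire (x : nat) st : option (seq (nat * nat)) :=
  let a := lookup st x in
  let st' := [seq y <- st | y.1 != x] in
  if a \in map snd st' then Some st' else if st' is [::] then Some st else None.

Definition state_trees st es : nat := trees (map fst st) (lookup st) es.

Lemma lookup_relabel f st x : x \in map fst st ->
  lookup (relabel f st) x = f (lookup st x).
Proof.
by elim: st => //= -[y a] st IH /=; rewrite inE; case: eqP => //= _ /IH.
Qed.

Lemma relabel_keys f st : map fst (relabel f st) = map fst st.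
Proof. by rewrite -map_comp. Qed.

Lemma lookup_mem st x : x \in map fst st -> (x, lookup st x) \in st.
Proof.
elim: st => //= -[y a] st IH /=; rewrite !inE; case: eqP => [->|_] /=; first by rewrite eqxx.
by move=> /IH ->; rewrite orbT.
Qed.

Lemma mem_lookup st x a : uniq (map fst st) -> (x, a) \in st -> lookup st x = a.
Proof.
elim: st => //= -[y b] st IH /= /andP[yN un]; rewrite inE => /predU1P[[-> ->]|xa].
  by rewrite eqxx.
case: eqP => [E|_]; last exact: IH.
by case/negP: yN; rewrite -E; apply/mapP; exists (x, a).
Qed.

Lemma lookup_filter (P : pred nat) st x : P x ->
  lookup [seq y <- st | P y.1] x = lookup st x.
Proof.
move=> Px; elim: st => //= -[y a] st IH /=; case: ifP => [_|Py] /=; rewrite IH //.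
by case: eqP => // E; rewrite -E Px in Py.
Qed.

Lemma state_trees_cons st u v es :
  u \in map fst st -> v \in map fst st -> {subset ends es <= map fst st} ->
  state_trees st ((u, v) :: es) =
  state_trees st es +
    (if lookup st u == lookup st v then 0 else state_trees (merge_state u v st) es).
Proof.
move=> ust vst sub; rewrite /state_trees /= /merge_state relabel_keys.
congr (_ + _); case: ifP => // _; apply: eq_trees => // x y xst yst.
by rewrite !lookup_relabel.
Qed.

Lemma state_trees_normalise st es : {subset ends es <= map fst st} ->
  state_trees (normalise st) es = state_trees st es.
Proof.
move=> sub; rewrite /state_trees relabel_keys; apply: eq_trees => // x y xst yst.
rewrite !lookup_relabel //.
have ind z : z \in map fst st -> lookup st z \in map snd st.
  by move=> /lookup_mem zst; apply/mapP; exists (z, lookup st z).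
apply/eqP/eqP => [E|-> //].
by rewrite -(nth_index 0 (ind x xst)) E nth_index ?ind.
Qed.

Lemma state_trees_retire x st es : uniq (map fst st) -> x \in map fst st ->
  x \notin ends es -> {subset ends es <= map fst st} ->
  state_trees st es =
    if retire x st is Some st' then state_trees st' es else 0.
Proof.
move=> un xst xes sub; rewrite /retire.
have keys : map fst [seq y <- st | y.1 != x] = [seq y <- map fst st | y != x].
  by rewrite filter_map.
case: ifP => [/mapP[[y a]]|alone].
  rewrite mem_filter /= => /andP[yx yst] E.
  rewrite /state_trees (trees_drop un xes (y := y)) //; last 2 first.
  - by apply/mapP; exists (y, a).
  - by rewrite (mem_lookup un yst).
  rewrite keys; apply: eq_trees => [z zes|z z'].
    by rewrite mem_filter sub // andbT; apply: contraNneq xes => <-.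
  rewrite !mem_filter => /andP[zx _] /andP[zx' _].
  by rewrite !(lookup_filter (P := fun y => y != x)).
case E: [seq y <- st | y.1 != x] => [//|[y a] st'].
have : (y, a) \in [seq y <- st | y.1 != x] by rewrite E mem_head.
rewrite mem_filter => /andP[/= yx yst].
rewrite /state_trees (trees_dead xes xst (y := y)) //.
  by apply/mapP; exists (y, a).
move=> z zst zx; apply: contraFN alone => /eqP <-.
apply/mapP; exists (z, lookup st z) => //; rewrite mem_filter zx /=; exact: lookup_mem.
Qed.

Definition retire_all xs st : option (seq (nat * nat)) :=
  foldl (fun o x => obind (retire x) o) (Some st) xs.

Lemma retire_keys x st st' : uniq (map fst st) -> retire x st = Some st' ->
  uniq (map fst st') /\ (forall z, z \in map fst st -> z != x -> z \in map fst st').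
Proof.
have keys : map fst [seq y <- st | y.1 != x] = [seq y <- map fst st | y != x].
  by rewrite filter_map.
rewrite /retire => un; case: ifP => _ => [[<-]|].
  rewrite keys filter_uniq //; split=> // z zst zx.
  by rewrite mem_filter zx.
by case: [seq _ <- _ | _] => // -[<-].
Qed.

Definition live es st := uniq (map fst st) /\ {subset ends es <= map fst st}.

Lemma retire_allP xs st es : uniq xs -> {subset xs <= map fst st} ->
  {in xs, forall x, x \notin ends es} -> live es st ->
  (forall st', retire_all xs st = Some st' -> live es st') /\
  state_trees st es = oapp (fun st' => state_trees st' es) 0 (retire_all xs st).
Proof.
elim: xs st => [|x xs IH] st /=; first by move=> _ _ _ lv; split=> [st' [<-]|].
move=> /andP[xNxs uxs] sub xsN [un esub].
have xst : x \in map fst st by apply: sub; apply: mem_head.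
have xN : x \notin ends es by apply: xsN; apply: mem_head.
rewrite (state_trees_retire un xst xN esub) /retire_all /=.
case E: (retire x st) => [st'|]; last first.
  have -> : foldl (fun o y => obind (retire y) o) None xs = None by elim: (xs).
  by split.
have [un' sub'] := retire_keys un E.
apply: IH => // [z zxs|z zxs|].
- apply: sub'; first by apply: sub; rewrite inE zxs orbT.
  by apply: contraNneq xNxs => <-.
- by apply: xsN; rewrite inE zxs orbT.
split=> // z zes; apply: sub'; first exact: esub.
by apply: contraNneq xN => <-.
Qed.

Definition tree_step (ahead : seq (nat * nat)) (e : nat * nat)
    (states : seq (tree_state * N)) : seq (tree_state * N) :=
  let done := undup [seq x <- [:: e.1; e.2] | x \notin ends ahead] in
  collect N.add (pmap
    (fun sw => omap (fun st => (normalise st, sw.2)) (retire_all done sw.1))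
    (flatten [seq
      if lookup sw.1 e.1 == lookup sw.1 e.2 then [:: sw]
      else [:: sw; (merge_state e.1 e.2 sw.1, sw.2)] | sw <- states])).

Fixpoint tree_dp es (states : seq (tree_state * N)) : N :=
  if es is e :: es' then tree_dp es' (tree_step es' e states)
  else foldr (fun sw => N.add (if constant (map snd sw.1) then sw.2 else N0)) N0 states.

Definition tree_count (n : nat) es : N :=
  tree_dp es [:: ([seq (x, x) | x <- iota 0 n], N.one)].

Definition weighted_trees es (states : seq (tree_state * N)) : nat :=
  \sum_(sw <- states) N.to_nat sw.2 * state_trees sw.1 es.

Lemma live_relabel f es st : live es st -> live es (relabel f st).
Proof. by rewrite /live relabel_keys. Qed.

Lemma tree_stepP e es states : {in map fst states, forall st, live (e :: es) st} ->
  weighted_trees (e :: es) states = weighted_trees es (tree_step es e states) /\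
  {in map fst (tree_step es e states), forall st, live es st}.
Proof.
case: e => u v lv; rewrite /tree_step; set done := undup _.
set branches := flatten _.
have doneP (st : tree_state) : live ((u, v) :: es) st ->
    [/\ uniq done, {subset done <= map fst st} & {in done, forall x, x \notin ends es}].
  case=> un sub; split; first exact: undup_uniq.
    move=> x; rewrite mem_undup mem_filter => /andP[_ xuv]; apply: sub.
    by move: xuv; rewrite !inE => /orP[]->; rewrite ?orbT.
  by move=> x; rewrite mem_undup mem_filter => /andP[].
have branch_live : {in map fst branches, forall st, live ((u, v) :: es) st}.
  move=> _ /mapP[[st w] /flatten_mapP[[st0 w0] st0in +] ->] /=.
  have lv0 : live ((u, v) :: es) st0 by apply: lv; apply/mapP; exists (st0, w0).
  case: ifP => _; rewrite !inE; first by move=> /eqP[-> _].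
  by move=> /orP[]/eqP[-> _] //; apply: live_relabel.
have sub_live (st : tree_state) : live ((u, v) :: es) st -> live es st.
  by case=> un sub; split=> // z zes; apply: sub; rewrite !inE zes !orbT.
split; last first.
  move=> st /collect_keys/mapP[[st' w'] + ->] /=.
  rewrite mem_pmap => /mapP[[st1 w1] st1in /=].
  have lv1 : live ((u, v) :: es) st1 by apply: branch_live; apply/mapP; exists (st1, w1).
  have [d1 d2 d3] := doneP _ lv1.
  have [out _] := retire_allP d1 d2 d3 (sub_live _ lv1).
  by case E: (retire_all done st1) => [st2|] //= [-> _]; apply/live_relabel/out.
rewrite /weighted_trees (big_collect (f := fun st w => N.to_nat w * state_trees st es));
  last by move=> st w w'; rewrite N2Nat.inj_add -[RHS]mulnDl.
rewrite big_pmap.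
have -> : \sum_(sw <- branches) oapp (fun sw' : tree_state * N =>
      N.to_nat sw'.2 * state_trees sw'.1 es) 0
      (omap (fun st => (normalise st, sw.2)) (retire_all done sw.1)) =
   \sum_(sw <- branches) N.to_nat sw.2 * state_trees sw.1 es.
  rewrite big_seq [RHS]big_seq; apply: eq_bigr => -[st w] stin.
  have lv1 : live ((u, v) :: es) st by apply: branch_live; apply/mapP; exists (st, w).
  have [d1 d2 d3] := doneP _ lv1.
  have [out ->] := retire_allP d1 d2 d3 (sub_live _ lv1).
  case E: (retire_all done st) => [st2|] /=; last by rewrite muln0.
  by rewrite state_trees_normalise //; case: (out _ E).
rewrite /branches big_flatten big_map big_seq [RHS]big_seq.
apply: eq_bigr => -[st w] stin /=.
have [un sub] : live ((u, v) :: es) st by apply: lv; apply/mapP; exists (st, w).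
rewrite state_trees_cons //; try by apply: sub; rewrite !inE eqxx ?orbT.
  by case: ifP => _; rewrite !big_cons big_nil /= ?addn0 // mulnDr.
by move=> z zes; apply: sub; rewrite !inE zes !orbT.
Qed.

Lemma tree_dpP es states : {in map fst states, forall st, live es st} ->
  N.to_nat (tree_dp es states) = weighted_trees es states.
Proof.
elim: es states => [|e es IH] states lv /=; last first.
  by have [-> lv'] := tree_stepP lv; rewrite IH.
rewrite /weighted_trees; elim: states lv => [|[st w] states IH] lv; first by rewrite big_nil.
rewrite big_cons /= N2Nat.inj_add IH; last by move=> z zin; apply: lv; rewrite inE zin orbT.
congr (_ + _); have [un _] : live [::] st by apply: lv; apply: mem_head.
rewrite /state_trees /= -map_comp.
have -> : [seq (lookup st \o fst) i | i <- st] = map snd st.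
  by apply/eq_in_map => -[x a] xst /=; apply: mem_lookup.
by case: constant; rewrite /= ?muln1 ?muln0.
Qed.

Lemma tree_countP n es : {subset ends es <= iota 0 n} ->
  N.to_nat (tree_count n es) = trees (iota 0 n) id es.
Proof.
move=> sub; rewrite /tree_count tree_dpP; last first.
  move=> st; rewrite inE => /eqP ->; split; rewrite -map_comp map_id ?iota_uniq //.
rewrite /weighted_trees big_seq1 /= mul1n /state_trees -map_comp map_id.
have look : {in iota 0 n, lookup [seq (x, x) | x <- iota 0 n] =1 id}.
  move=> x xn; apply: mem_lookup; first by rewrite -map_comp map_id iota_uniq.
  by apply/mapP; exists x.
by apply: eq_trees => // x y xn yn; rewrite !look.
Qed.

End TreeStates.

Lemma lgraph_spanning_trees m L es : cubic_lists m L ->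
  perm_eq es (edge_list m L) ->
  spanning_tree_count (lgraph m L) = N.to_nat (tree_count m.+1 es).
Proof.
move=> cub esP; rewrite (spanning_tree_count_trees cub esP) tree_countP // => x.
move=> /flatten_mapP[p]; rewrite (perm_mem esP) => /(edge_list_lt cub)[lt1 lt2].
by rewrite mem_iota /= add0n !inE => /orP[]/eqP->.
Qed.

(** * Isomorphisms and automorphisms *)

Section IsomorphismSearch.
Variables (m : nat) (L L' : seq (seq nat)).
Hypotheses (cub : cubic_lists m L) (cub' : cubic_lists m L').
Let n := m.+1.
Let G := lgraph m L.
Let H := lgraph m L'.

(** Backtracking search, breadth first: partial maps, listed as (vertex, image),
    are extended in all ways that stay injective and preserve both edges and
    non-edges. *)
Definition iso_step (maps : seq (seq (nat * nat))) (v : nat) :=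
  flatten [seq [seq (v, w) :: s | w <- iota 0 n &
    all (fun p => (p.2 != w) &&
      ((w \in nth [::] L' p.2) == (v \in nth [::] L p.1))) s] | s <- maps].

Definition iso_maps (vs : seq nat) := foldl iso_step [:: [::]] vs.

Lemma iso_in_maps (f : G -> H) vs :
  injective f -> (forall x y, adj (f x) (f y) = adj x y) ->
  uniq vs -> {in vs, forall v, v < n} ->
  [seq (v, val (f (inord v : 'I_n))) | v <- rev vs] \in iso_maps vs.
Proof.
move=> fI fadj; elim/last_ind: vs => [|vs v IH] //=.
rewrite rcons_uniq => /andP[vNvs uvs] sub.
have lt u : u \in rcons vs v -> u < n by apply: sub.
rewrite /iso_maps foldl_rcons -/(iso_maps vs) rev_rcons map_cons /iso_step.
apply/flatten_mapP; exists [seq (v, val (f (inord v : 'I_n))) | v <- rev vs].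
  by apply: IH => // u uvs'; apply: sub; rewrite mem_rcons inE uvs' orbT.
apply: map_f; rewrite mem_filter mem_iota /= add0n ltn_ord andbT.
apply/allP => _ /mapP[u + ->] /=; rewrite mem_rev => uvs'.
have [ltu ltv] : u < n /\ v < n.
  by split; apply: lt; rewrite mem_rcons inE ?uvs' ?eqxx ?orbT.
apply/andP; split.
  apply: contraNneq vNvs => /val_inj/fI/(congr1 val).
  by rewrite /= !inordK // => <-.
rewrite -(linkE cub') ?ltn_ord // -(linkE cub) //; apply/eqP.
have := fadj (inord u : 'I_n) (inord v : 'I_n).
by rewrite /= !inordK.
Qed.

Lemma not_isomorphic vs : uniq vs -> {in vs, forall v, v < n} ->
  iso_maps vs = [::] -> ~ isomorphic G H.
Proof.
move=> uvs sub E [f [/bij_inj fI fadj]].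
by have := iso_in_maps fI fadj uvs sub; rewrite E.
Qed.

End IsomorphismSearch.

Section AutomorphismCount.
Variables (m : nat) (L : seq (seq nat)) (vs : seq nat).
Hypotheses (cub : cubic_lists m L) (vsP : perm_eq vs (iota 0 m.+1)).
Let n := m.+1.
Let G := lgraph m L.

Let vsU : uniq vs. Proof. by rewrite (perm_uniq vsP) iota_uniq. Qed.
Let vs_lt : {in vs, forall v, v < n}.
Proof. by move=> v; rewrite (perm_mem vsP) mem_iota. Qed.
Let mem_vs (u : G) : val u \in vs.
Proof. by rewrite (perm_mem vsP) mem_iota ltn_ord. Qed.

Definition graph_of (s : {perm G}) : seq (nat * nat) :=
  [seq (v, val (s (inord v : 'I_n))) | v <- rev vs].

Lemma iso_maps_uniq ws : uniq (iso_maps m L L ws).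
Proof.
elim/last_ind: ws => [|ws w IH] //.
rewrite /iso_maps foldl_rcons -/(iso_maps m L L ws) /iso_step.
apply: allpairs_uniq_dep => // [s _|[s x] [s' x'] _ _ /= [-> ->]] //.
by rewrite filter_uniq ?iota_uniq.
Qed.

Definition compatible (p q : nat * nat) : bool :=
  (p.2 != q.2) && (link L q.2 p.2 == link L q.1 p.1).

Lemma iso_maps_sound ws s : {in ws, forall w, w < n} -> s \in iso_maps m L L ws ->
  [/\ map fst s = rev ws, all (fun p => p.2 < n) s & pairwise compatible s].
Proof.
elim/last_ind: ws s => [|ws w IH] s ltw; first by rewrite inE => /eqP ->.
rewrite /iso_maps foldl_rcons -/(iso_maps m L L ws) /iso_step rev_rcons.
have ltws : {in ws, forall w, w < n} by move=> x xws; apply: ltw; rewrite mem_rcons inE xws orbT.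
case/flatten_mapP => s' /(IH _ ltws)[keys lts pw] /mapP[x].
rewrite mem_filter mem_iota => /andP[/allP ok /andP[_ ltx]] ->.
split; rewrite /= ?keys ?lts ?pw ?andbT //.
apply/allP => p ps; have /andP[px /eqP E] := ok p ps.
have ltp1 : p.1 < n by apply: ltws; rewrite -mem_rev -keys map_f.
rewrite /compatible eq_sym px /= !(linkE cub) ?E //; exact: (allP lts).
Qed.

Lemma iso_maps_perm s : s \in iso_maps m L L vs ->
  exists2 p : {perm G}, p \in automorphisms G & graph_of p = s.
Proof.
move=> /(iso_maps_sound vs_lt)[keys lts pw].
pose f (u : 'I_n) : 'I_n := inord (nth 0 (map snd s) (index (val u) (map fst s))).
have ind (u : 'I_n) : index (val u) (map fst s) < size s.
  by rewrite -(size_map fst) index_mem keys mem_rev mem_vs.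
have fE (u : 'I_n) : (val u, val (f u)) = nth (0, 0) s (index (val u) (map fst s)).
  set p := nth _ _ _; have lt : p.2 < n by apply: (allP lts); apply: mem_nth.
  have -> : val (f u) = p.2 by rewrite /f (nth_map (0, 0)) // -/p /= inordK.
  have <- : p.1 = val u.
    by rewrite -(nth_map (0, 0) 0 fst) // nth_index // keys mem_rev mem_vs.
  by case: p lt.
have cmp (u v : 'I_n) : u != v ->
    f u != f v /\ link L (f u) (f v) = link L u v.
  wlog lt : u v / index (val u) (map fst s) < index (val v) (map fst s).
    move=> wl uv; have : index (val u) (map fst s) != index (val v) (map fst s).
      apply: contraNneq uv => E; apply/eqP/val_inj.
      by have := fE u; rewrite E -fE => -[].
    rewrite neq_ltn => /orP[lt|lt]; first exact: wl.
    by have [|fvu E] := wl _ _ lt; rewrite 1?eq_sym // link_sym E link_sym.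
  move=> uv; have /(pairwiseP (0, 0)) := pw; move/(_ _ _ (ind u) (ind v) lt).
  rewrite -!fE => /andP[/= ne /eqP E].
  by split; [apply: contraNneq ne => -> | rewrite link_sym E link_sym].
have fI : injective f.
  by move=> u v E; apply/eqP; apply: contraT => /cmp[]; rewrite E eqxx.
exists (perm fI : {perm G}).
  rewrite inE; apply/forallP => u; apply/forallP => v; apply/eqP.
  have [->|uv] := eqVneq u v; first by rewrite !adj_irrefl.
  by rewrite /= !permE; have [_] := cmp u v uv.
rewrite /graph_of -keys -map_comp -[RHS]map_id; apply/eq_in_map => -[x y] xys /=.
have ltx : x < n by apply: vs_lt; rewrite -mem_rev -keys; apply/mapP; exists (x, y).
have ux : uniq (map fst s) by rewrite keys rev_uniq.
have := fE (inord x); rewrite /= inordK // permE => ->.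
(* The keys are distinct, so the position of x among them is that of (x, y). *)
have {1}<- : (nth (0, 0) s (index (x, y) s)).1 = x by rewrite nth_index.
by rewrite -(nth_map _ 0) ?index_mem // index_uniq ?size_map ?index_mem // nth_index.
Qed.

(** The search is exact: completeness is [iso_in_maps], and by [iso_maps_sound]
    every complete map preserves adjacency on all pairs. *)
Lemma aut_order_iso_maps : aut_order G = size (iso_maps m L L vs).
Proof.
have graphI : injective graph_of.
  move=> p q /eq_in_map E; apply/permP => u.
  have := E (val u); rewrite mem_rev mem_vs => /(_ isT) [].
  by rewrite inord_val => /val_inj.
rewrite /aut_order cardE -(size_map graph_of); apply/perm_size/uniq_perm.
- by rewrite map_inj_uniq ?enum_uniq.
- exact: iso_maps_uniq.
move=> s; apply/mapP/idP => [[p + ->]|/iso_maps_perm[p pA <-]]; last first.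
  by exists p; rewrite ?mem_enum.
rewrite mem_enum inE => /forallP aut; apply: iso_in_maps => //; first exact: perm_inj.
by move=> x y; have /forallP/(_ y)/eqP := aut x.
Qed.

End AutomorphismCount.

(** * Cospectrality by intertwining matrices *)

Section Cospectrality.
Import Order.TTheory GRing.Theory Num.Theory.
Local Open Scope ring_scope.

(** If P A = B P then P (X - A) = (X - B) P; take determinants and cancel
    det P. *)
Lemma char_poly_intertwined (R : idomainType) k (P A B : 'M[R]_k) :
  \det P != 0 -> P *m A = B *m P -> char_poly A = char_poly B.
Proof.
move=> detP PA; have detPC : \det (map_mx polyC P) != 0.
  by rewrite det_map_mx polyC_eq0.
apply: (mulfI detPC); rewrite [RHS]mulrC -!det_mulmx.
congr (\det _); rewrite /char_poly_mx mulmxBl mulmxBr -!map_mxM PA.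
by rewrite mul_scalar_mx mul_mx_scalar.
Qed.

(** An inverse modulo p keeps the entries of the certificate below p, whereas
    those of a rational inverse would be large. *)
Lemma det_neq0_mod (p k : nat) (P Q : 'M[int]_k) : prime p ->
  (forall i j, (p %| (P *m Q) i j - (i == j)%:R)%Z) -> \det P != 0.
Proof.
move=> pr_p PQ; apply/eqP => detP0.
have E : map_mx intr P *m map_mx intr Q = 1%:M :> 'M['F_p]_k.
  apply/matrixP => i j; rewrite -map_mxM !mxE.
  have := PQ i j; rewrite mxE => /dvdzP[q /eqP]; rewrite subr_eq => /eqP ->.
  rewrite rmorphD rmorphM /= [(p%:Z)%:~R]pchar_Fp_0 // mulr0 add0r.
  by rewrite rmorph_nat.
have := congr1 determinant E; rewrite det1 det_mulmx det_map_mx detP0 rmorph0.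
by move/eqP; rewrite mul0r eq_sym oner_eq0.
Qed.

Section Intertwining.
Variables (m : nat) (L L' : seq (seq nat)).
Hypotheses (cub : cubic_lists m L) (cub' : cubic_lists m L').
Let n := m.+1.
Let G := lgraph m L.
Let H := lgraph m L'.

Definition support_mx (R : pzRingType) (S : seq (seq nat)) : 'M[R]_#|G| :=
  \matrix_(i, j) (val (enum_val j : 'I_n) \in nth [::] S (val (enum_val i : 'I_n)))%:R.

(** For a 0/1 matrix given by the supports of its rows, the (i, j) entries of
    P A and A' P are cardinalities. *)
Definition intertwines (S : seq (seq nat)) : bool :=
  all (fun i => all (fun j =>
    count (mem (nth [::] S i)) (nth [::] L j) ==
    count (fun k => j \in nth [::] S k) (nth [::] L' i)) (iota 0 n)) (iota 0 n).

Definition inverse_mod (p : nat) (S Q : seq (seq nat)) : bool :=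
  all (fun i => all (fun j =>
    sumn [seq (k \in nth [::] S i) * nth 0 (nth [::] Q k) j | k <- iota 0 n]
    == (i == j) %[mod p])%N (iota 0 n)) (iota 0 n).

Lemma sum_vertices (V : nmodType) (f : nat -> V) :
  \sum_(i < #|G|) f (enum_val i : 'I_n) = \sum_(k <- iota 0 n) f k.
Proof.
rewrite -(big_enum_val (fun u : 'I_n => f u)).
rewrite -[iota 0 n]/(index_iota 0 n) big_mkord; exact: eq_bigl.
Qed.

Lemma sum_nb (R : pzRingType) K (i : nat) (f : pred nat) : cubic_lists m K -> (i < n)%N ->
  \sum_(k <- iota 0 n) (f k)%:R * (link K k i)%:R = (count f (nth [::] K i))%:R :> R.
Proof.
move=> cubK lti; have [_ un sub] := cubicP cubK lti.
have /seq.permP filt : perm_eq [seq k <- iota 0 n | link K k i] (nth [::] K i).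
  apply: uniq_perm; rewrite ?filter_uniq ?iota_uniq // => k.
  rewrite mem_filter mem_iota /= add0n link_sym (linkE cubK) // andbC.
  by case: (boolP (k \in _)) => [/sub[->]|]; rewrite ?andbF.
rewrite -filt count_filter -sum1_count natr_sum [RHS]big_mkcond.
by apply: eq_bigr => k _; rewrite -natrM mulnb /=; case: (f k && _).
Qed.

Lemma intertwines_mx (R : comPzRingType) S : intertwines S ->
  support_mx R S *m (\matrix_(i, j) (link L (enum_val i : 'I_n) (enum_val j : 'I_n))%:R) =
  (\matrix_(i, j) (link L' (enum_val i : 'I_n) (enum_val j : 'I_n))%:R) *m support_mx R S.
Proof.
move=> /allP ok; apply/matrixP => i j.
pose u : 'I_n := enum_val i; pose v : 'I_n := enum_val j.
have := ok u; rewrite mem_iota ltn_ord => /(_ isT)/allP/(_ v).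
rewrite mem_iota ltn_ord => /(_ isT)/eqP E.
transitivity ((count (mem (nth [::] S u)) (nth [::] L v))%:R : R).
  rewrite -(sum_nb _ _ cub) // -sum_vertices mxE; apply: eq_bigr => k _.
  by rewrite !mxE.
rewrite E -(sum_nb _ _ cub') // -sum_vertices mxE; apply: eq_bigr => k _.
by rewrite !mxE mulrC link_sym.
Qed.

Lemma inverse_mod_det p S Q : prime p -> inverse_mod p S Q ->
  \det (support_mx int S) != 0.
Proof.
move=> pr_p /allP ok.
pose Qmx : 'M[int]_#|G| :=
  \matrix_(i, j) (nth 0%N (nth [::] Q (enum_val i : 'I_n)) (enum_val j : 'I_n))%:R.
apply: (det_neq0_mod (Q := Qmx) pr_p) => i j.
pose u : 'I_n := enum_val i; pose v : 'I_n := enum_val j.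
have := ok u; rewrite mem_iota ltn_ord => /(_ isT)/allP/(_ v).
rewrite mem_iota ltn_ord => /(_ isT).
have -> : (val u == val v) = (i == j) by rewrite (inj_eq val_inj) (inj_eq enum_val_inj).
set s := sumn _ => /eqP smod.
have -> : (support_mx int S *m Qmx) i j = s%:R.
  rewrite /s sumnE big_map natr_sum -sum_vertices mxE; apply: eq_bigr => k _.
  by rewrite !mxE -natrM.
by rewrite -eqz_mod_dvd !natz !modz_nat smod.
Qed.

Lemma laplacian_cubic K : cubic_lists m K ->
  laplacian_mx (lgraph m K) = 3%:R%:M - adjacency_mx (lgraph m K).
Proof.
move=> cubK; congr (_ - _); apply/matrixP => i j; rewrite !mxE.
by rewrite (lgraph_cubic cubK).
Qed.

(** The Laplacian of a cubic graph is 3 - A, so the same matrix intertwines the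
    Laplacians. *)
Lemma intertwined_spectra p S Q : prime p -> intertwines S -> inverse_mod p S Q ->
  spectrum (adjacency_mx G) = spectrum (adjacency_mx H) /\
  spectrum (laplacian_mx G) = spectrum (laplacian_mx H).
Proof.
move=> pr_p /(intertwines_mx algC) PA /(inverse_mod_det pr_p) detP.
have detP' : \det (support_mx algC S) != 0.
  have -> : support_mx algC S = map_mx intr (support_mx int S).
    by apply/matrixP => i j; rewrite !mxE rmorph_nat.
  by rewrite det_map_mx intr_eq0.
have PL : support_mx algC S *m laplacian_mx G =
          laplacian_mx H *m support_mx algC S.
  rewrite (laplacian_cubic cub) (laplacian_cubic cub') mulmxBr mulmxBl PA.
  by rewrite mul_scalar_mx mul_mx_scalar.
by rewrite /spectrum (char_poly_intertwined detP' PA) (char_poly_intertwined detP' PL).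
Qed.

End Intertwining.

End Cospectrality.

(** * Certificates for the remaining invariants *)

Lemma ordered_eq i j k l : ordered i j = ordered k l ->
  (i = k /\ j = l) \/ (i = l /\ j = k).
Proof.
rewrite /ordered; case: (leqP i j) => _; case: (leqP k l) => _ [-> ->];
  by [left | right].
Qed.

Section Certificates.
Variables (m : nat) (L : seq (seq nat)).
Hypothesis cub : cubic_lists m L.
Let n := m.+1.
Let G := lgraph m L.
Let nb i := nth [::] L i.
Let vtx (i : nat) : G := (inord i : 'I_n).

Lemma vtxK i : i < n -> val (vtx i) = i.
Proof. by move=> lti; rewrite /vtx /= inordK. Qed.

Lemma vtx_val (u : G) : vtx (val u) = u.
Proof. exact: inord_val. Qed.

Lemma adj_vtx i j : i < n -> j < n -> adj (vtx i) (vtx j) = (j \in nb i).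
Proof. by move=> lti ltj; rewrite (adjE cub) /= !inordK. Qed.

Lemma all_vtx (P : nat -> bool) : all P (iota 0 n) -> forall u : G, P (val u).
Proof. by move=> /allP ok u; apply: ok; rewrite mem_iota ltn_ord. Qed.

Lemma card_vtx (s : seq nat) : uniq s -> {in s, forall i, i < n} ->
  #|[set u in map vtx s]| = size s.
Proof.
move=> us lts; rewrite cardsE -(size_map vtx); apply/card_uniqP.
rewrite map_inj_in_uniq // => i j si sj /(congr1 val).
by rewrite !vtxK ?lts.
Qed.

Lemma mem_vtx (s : seq nat) (u : G) : {in s, forall i, i < n} ->
  (u \in map vtx s) = (val u \in s).
Proof.
move=> lts; apply/mapP/idP => [[i si ->]|us]; first by rewrite vtxK ?lts.
by exists (val u); rewrite ?vtx_val.
Qed.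

Lemma hamiltonian_circumference_lgraph :
  2 < n -> path.cycle (link L) (iota 0 n) -> circumference G = n.
Proof.
move=> lt2 cyc; rewrite -[RHS]card_ord.
apply: (hamiltonian_circumference (c := enum_tuple G)); rewrite ?card_ord //.
rewrite /ucycleb enum_uniq andbT -[path.cycle _ _]/(path.cycle (relpre val (link L)) (enum 'I_n)).
by rewrite -cycle_map val_enum_ord.
Qed.

Section Triangle.
Variables a b c : nat.
Hypothesis abc : [&& a < n, b < n, c < n, b \in nb a, c \in nb b & a \in nb c].

Lemma triangle_vtx :
  [/\ adj (vtx a) (vtx b), adj (vtx b) (vtx c) & adj (vtx c) (vtx a)].
Proof.
case/and4P: abc => lta ltb ltc /and3P[ab bc ca].
by rewrite !adj_vtx.
Qed.

Lemma girth_lgraph : 2 < n -> girth G = 3.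
Proof.
have [ab bc ca] := triangle_vtx => lt2; apply: triangle_girth ab bc ca _.
by rewrite card_ord.
Qed.

Lemma chromatic_number_lgraph (col : seq nat) :
  2 < n ->
  all (fun i => (nth 0 col i < 3) && all (fun j => nth 0 col i != nth 0 col j) (nb i)) (iota 0 n) ->
  chromatic_number G = 3.
Proof.
have [ab bc ca] := triangle_vtx => lt2 /all_vtx ok.
apply: (chromatic_rel_eq3 ab bc ca); last by rewrite card_ord.
apply/existsP; exists [ffun u : G => inord (nth 0 col (val u))].
apply/forallP => u; apply/forallP => v; apply/implyP; rewrite (adjE cub) !ffunE.
have /andP[ltu /allP/(_ (val v)) uv] := ok u; have /andP[ltv _] := ok v.
move=> /uv; apply: contra => /eqP/(congr1 val).
by rewrite /= !inordK // => ->.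
Qed.

Lemma clique_number_lgraph :
  all (fun i => has (fun x => has (fun y => (x != y) && (y \notin nb x)) (nb i)) (nb i)) (iota 0 n) ->
  clique_number G = 3.
Proof.
have [ab bc ca] := triangle_vtx => /all_vtx ok.
have nadj (x y : G) : adj x y -> x != y.
  by apply: contraTneq => ->; rewrite adj_irrefl.
apply: bigmax_eq => [|K clq].
  exists [set vtx a; vtx b; vtx c].
    apply/forall_inP => x + ; rewrite !inE -orbA => xE.
    apply/forall_inP => y; rewrite !inE -orbA => yE; apply/implyP.
    by move: xE yE => /or3P[]/eqP-> /or3P[]/eqP->; rewrite ?eqxx // adj_sym.
  rewrite setUC cardsU1 cards2 !inE negb_or (nadj _ _ ca).
  by rewrite [vtx c == vtx b]eq_sym (nadj _ _ bc) (nadj _ _ ab).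
apply: (clique_upper (lgraph_cubic cub)) clq => v.
have /hasP[x xv /hasP[y yv /andP[xy nxy]]] := ok v.
have [_ _ H] := cubicP cub (ltn_ord v).
have [[ltx _ _] [lty _ _]] := (H x xv, H y yv).
exists (vtx x), (vtx y); split; rewrite ?adj_vtx //.
- by rewrite inE (adjE cub) vtxK.
- by rewrite inE (adjE cub) vtxK.
by apply: contraNneq xy => /(congr1 val); rewrite !vtxK // => ->.
Qed.
End Triangle.

(** A colouring c of pairs of vertices colours an edge through either order of
    its ends.  The three edges at vertex 0 give the lower bound. *)
Lemma chromatic_index_lgraph (c : nat -> nat -> nat) :
  all (fun i => uniq (map (c i) (nb i)) &&
    all (fun j => (c i j < 3) && (c i j == c j i)) (nb i)) (iota 0 n) ->
  chromatic_index G = 3.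
Proof.
move=> /all_vtx ok; rewrite /chromatic_index.
pose T : finType := {e : {set G} | e \in edges G}.
pose ends (e : T) : G * G :=
  odflt (vtx 0, vtx 0) [pick p | adj p.1 p.2 && (val e == [set p.1; p.2])].
have endsP (e : T) : adj (ends e).1 (ends e).2 /\ val e = [set (ends e).1; (ends e).2].
  rewrite /ends; case: pickP => [p /andP[pa /eqP]//|none].
  have /imsetP[p pa E] := valP e; have := none p.
  by rewrite inE in pa; rewrite pa E eqxx.
pose col (e : T) := c (val (ends e).1) (val (ends e).2).
have csym (u v : G) : adj u v -> c (val u) (val v) < 3 /\ c (val u) (val v) = c (val v) (val u).
  by rewrite (adjE cub) => uv; have /andP[_ /allP/(_ _ uv)/andP[lt /eqP]] := ok u.
have colE (e : T) (u v : G) : val e = [set u; v] -> adj u v ->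
    col e = c (val u) (val v).
  have [ea ->] := endsP e; move=> /(@set2_ordered m L)/ordered_eq E uv.
  rewrite /col; case: E => -[E1 E2].
    by rewrite (E1 : val (ends e).1 = val u) (E2 : val (ends e).2 = val v).
  rewrite (E1 : val (ends e).1 = val v) (E2 : val (ends e).2 = val u).
  by have [_ ->] := csym _ _ uv.
have col3 (e : T) : col e < 3 by have [/csym[]] := endsP e.
have edge (v u : G) (uv : u \in nbh v) : {e : T | val e = [set v; u]}.
  rewrite inE in uv; have eE : [set v; u] \in edges G by rewrite (mem_edges_ordered cub).
  by exists (@exist _ (fun e : {set G} => e \in edges G) _ eE).
have [x [y [z [xv yv zv [xy yz zx]]]]] : exists x y z, [/\ x \in nbh (vtx 0),
    y \in nbh (vtx 0), z \in nbh (vtx 0) & [/\ x != y, y != z & z != x]].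
  have : #|nbh (vtx 0)| = 3 by apply: lgraph_cubic cub _.
  rewrite cardE; move: (enum_uniq (nbh (vtx 0))) (mem_enum (nbh (vtx 0))).
  case: (enum _) => [|x [|y [|z []]]] //= + memE _.
  rewrite !inE negb_or => /and3P[/andP[xy xz] yz _].
  exists x, y, z; rewrite -!memE !inE !eqxx ?orbT; split=> //; split=> //.
  by rewrite eq_sym.
have [[[ex exE] [ey eyE]] [ez ezE]] := (edge _ _ xv, edge _ _ yv, edge _ _ zv).
have share (e f : T) u w : val e = [set vtx 0; u] -> val f = [set vtx 0; w] -> u != w ->
    w \in nbh (vtx 0) ->
    (e != f) && (val e :&: val f != set0).
  move=> eE fE uw wv; apply/andP; split; last first.
    by apply/set0Pn; exists (vtx 0); rewrite eE fE !inE eqxx.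
  apply: contraNneq uw => ef; have : w \in val e by rewrite ef fE set22.
  rewrite eE !inE eq_sym [w == u]eq_sym => /orP[/eqP E|//].
  by rewrite inE -E adj_irrefl in wv.
have r3 : [&& (ex != ey) && (val ex :&: val ey != set0),
  (ey != ez) && (val ey :&: val ez != set0) & (ez != ex) && (val ez :&: val ex != set0)].
  by rewrite (share _ _ _ _ exE eyE) // (share _ _ _ _ eyE ezE) // (share _ _ _ _ ezE exE).
have [rxy ryz rzx] := and3P r3.
pose r : rel T := fun e f => (e != f) && (val e :&: val f != set0).
apply: (@chromatic_rel_eq3 T r ex ey ez rxy ryz rzx); last first.
  move: rxy ryz rzx => /andP[a _] /andP[b _] /andP[d _].
  by apply: (@card_gt2 T ex ey ez); rewrite /= !inE negb_or a b eq_sym d.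
apply/existsP; exists [ffun e => inord (col e)].
apply/forallP => e; apply/forallP => f; apply/implyP => /andP[ef /set0Pn[v]].
rewrite inE !ffunE => /andP[ve vf].
have other (g : T) : v \in val g -> exists2 w, adj v w & val g = [set v; w].
  have [ga ->] := endsP g; rewrite !inE => /orP[]/eqP->; first by exists (ends g).2.
  by exists (ends g).1; [rewrite adj_sym | rewrite setUC].
have [a va eE] := other e ve; have [b vb fE] := other f vf.
rewrite (colE e _ _ eE va) (colE f _ _ fE vb).
apply/eqP => /(congr1 val); rewrite /= !inordK; try by have [] := csym _ _ va; have [] := csym _ _ vb.
have /andP[un _] := ok v => cE.
case/eqP: ef; apply: val_inj; rewrite eE fE; congr [set _; _].
move: va vb; rewrite !(adjE cub) => va vb; apply: val_inj.
rewrite /= -(nth_index 0 va) -(nth_index 0 vb); congr nth.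
apply/eqP; rewrite -(nth_uniq 0 (s := map (c v) (nb v))) ?size_map ?index_mem //.
by rewrite !(nth_map 0) ?index_mem // !nth_index //; apply/eqP.
Qed.

(** The successors of the stable vertices are not stable.  A single edge counts
    as a cycle of length two. *)
Lemma stable_on_cycle (S : {set G}) (c : seq G) :
  [forall x in S, forall y in S, ~~ adj x y] ->
  uniq c -> path.cycle (@adj G) c -> 2 * count (mem S) c <= size c.
Proof.
move=> /forall_inP stab uc cyc.
(* [next c] permutes the cycle, so S has as many members as successors in S. *)
have nextS : count (mem S) c = count (fun x => next c x \in S) c.
  rewrite -(count_map (next c) (mem S)); apply/seq.permP; rewrite perm_sym.
  apply: uniq_perm => //; first by rewrite map_inj_uniq //; apply: can_inj (prev_next uc).
  move=> x; apply/mapP/idP => [[y yc ->]|xc]; first by rewrite mem_next.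
  by exists (prev c x); rewrite ?mem_prev ?next_prev.
rewrite mul2n -addnn {2}nextS -count_predUI.
rewrite [X in _ + X](_ : _ = 0) ?addn0 ?count_size //.
apply/eqP; rewrite -leqn0 leqNgt -has_count; apply/hasPn => x xc /=.
apply/negP => /andP[xS nS].
by have /forall_inP/(_ _ nS)/negP[] := stab x xS; apply: next_cycle.
Qed.

(** The vertices are partitioned into edges and cycles, each containing at most
    half of its vertices, rounded down, from a stable set. *)
Lemma independence_number_lgraph (s : seq nat) (cs : seq (seq nat)) :
  uniq s -> all (fun i => (i < n) && all (fun j => j \notin nb i) s) s ->
  perm_eq (flatten cs) (iota 0 n) -> all (path.cycle (link L)) cs ->
  sumn [seq (size c)./2 | c <- cs] = size s ->
  independence_number G = size s.
Proof.
move=> us /allP stab csP cyc sz.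
have lts : {in s, forall i, i < n} by move=> i /stab/andP[].
apply: bigmax_eq => [|S stabS].
  exists [set u in map vtx s]; last by rewrite card_vtx.
  apply/forall_inP => u; rewrite inE mem_vtx // => us'.
  apply/forall_inP => v; rewrite inE mem_vtx // => vs'.
  by rewrite (adjE cub); have /andP[_ /allP/(_ _ vs')] := stab _ us'.
have -> : #|S| = count (mem S) (map vtx (flatten cs)).
  rewrite cardE -size_filter; apply/perm_size/uniq_perm; rewrite ?enum_uniq //.
    rewrite filter_uniq // (perm_uniq (perm_map vtx csP)) map_inj_in_uniq ?iota_uniq //.
    by move=> i j; rewrite !mem_iota => /andP[_ lti] /andP[_ ltj] /(congr1 val); rewrite !vtxK.
  move=> u; rewrite mem_enum mem_filter (perm_mem (perm_map vtx csP)).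
  rewrite (_ : u \in map vtx (iota 0 n)) ?andbT //.
  by apply/mapP; exists (val u); rewrite ?vtx_val // mem_iota ltn_ord.
rewrite -{}sz; have ucs : uniq (flatten cs) by rewrite (perm_uniq csP) iota_uniq.
have ltc : {in flatten cs, forall i, i < n}.
  by move=> i; rewrite (perm_mem csP) mem_iota.
elim: cs cyc ucs ltc {csP} => //= c cs IH /andP[cc cyc]; rewrite cat_uniq.
move=> /and3P[uc _ ucs] ltc; rewrite map_cat count_cat leq_add //; last first.
  by apply: IH => // i ics; apply: ltc; rewrite mem_cat ics orbT.
have ltc' : {in c, forall i, i < n} by move=> i ic; apply: ltc; rewrite mem_cat ic.
rewrite geq_half_double -mul2n -(size_map vtx) stable_on_cycle //.
  by rewrite map_inj_in_uniq // => i j /ltc' lti /ltc' ltj /(congr1 val); rewrite !vtxK.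
rewrite cycle_map; apply: (sub_in_cycle (P := [pred i | i < n])) cc; last exact/allP.
move=> i j lti ltj ij.
suff: @adj G (vtx i) (vtx j) by [].
by rewrite adj_vtx //; move: ij; rewrite (linkE cub).
Qed.

Lemma domination_number_lgraph (s : seq nat) :
  uniq s -> {in s, forall i, i < n} -> n <= 4 * size s < n + 4 ->
  all (fun i => (i \in s) || has (mem s) (nb i)) (iota 0 n) ->
  domination_number G = size s.
Proof.
move=> us lts /andP[_ lt] /all_vtx ok; apply: bigminn_eq.
- rewrite card_ord -[X in _ <= X](size_iota 0); apply: uniq_leq_size => // i /lts.
  by rewrite mem_iota.
- exists [set u in map vtx s]; last exact: card_vtx.
  apply/forallP => v; rewrite inE mem_vtx //.
  have /orP[->//|/hasP[j jv js]] := ok v; apply/orP; right.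
  apply/exists_inP; exists (vtx j); first by rewrite inE mem_vtx // vtxK ?lts.
  by rewrite (adjE cub) vtxK ?lts.
move=> D /(domination_lower (lgraph_cubic cub)); rewrite card_ord => le.
by rewrite -ltnS -(ltn_pmul2l (isT : 0 < 4)) mulnS addnC (leq_trans lt) // leq_add2r.
Qed.

Lemma matching_number_lgraph (s : seq (nat * nat)) :
  perm_eq (flatten [seq [:: p.1; p.2] | p <- s]) (iota 0 n) ->
  {subset s <= edge_list m L} -> uniq s ->
  matching_number G = size s.
Proof.
move=> perm sub us.
have szn : 2 * size s = n.
  rewrite -(size_iota 0 n) -(perm_size perm) size_flatten /shape -map_comp.
  by rewrite mulnC -[RHS]/(sumn (map (fun=> 2) s)); elim: (s) => //= p r IH; rewrite mulSn IH.
have inj : {in s &, injective (edge_of m L)}.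
  by move=> p q ps qs; apply: (edge_of_inj cub); apply: sub.
apply: bigmax_eq => [|M /andP[subM trM]]; last first.
  by rewrite -(leq_pmul2l (isT : 0 < 2)) szn -[n]card_ord; apply: matching_upper trM.
have cardM : #|[set e in map (edge_of m L) s]| = size s.
  rewrite cardsE -(size_map (edge_of m L)); apply/card_uniqP.
  by rewrite map_inj_in_uniq.
exists [set e in map (edge_of m L) s] => //; apply/andP; split.
  apply/subsetP => e; rewrite inE (edges_of cub) => /mapP[p ps ->].
  by apply: map_f; apply: sub.
rewrite /trivIset (eq_bigr (fun=> 2)); last first.
  move=> e; rewrite inE => /mapP[p ps ->]; apply: edge_card.
  by rewrite (edges_of cub); apply: map_f; apply: sub.
rewrite sum_nat_const cardM mulnC szn -[n]card_ord -cardsT eq_sym; apply/eqP.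
congr #|pred_of_set _|; apply/setP => u; rewrite inE; apply/bigcupP.
have : val u \in flatten [seq [:: p.1; p.2] | p <- s].
  by rewrite (perm_mem perm) mem_iota ltn_ord.
case/flatten_mapP => p ps up; exists (edge_of m L p); first by rewrite inE map_f.
move: up; rewrite !inE => /orP[]/eqP E; apply/orP; [left|right];
  by apply/eqP/val_inj; rewrite /= -E inord_val.
Qed.

End Certificates.

(** * The six graphs *)

Delimit Scope N_scope with bin.

(** The six graphs, in the notation for Hamiltonian cubic graphs: the
    vertices 0, ..., 21 are placed along a Hamiltonian cycle and the j-th entry
    is the third neighbour of j.  They are ordered so that consecutive graphs
    are related by sparse intertwiners. *)
Definition chords : seq (seq nat) :=
  [:: [:: 7; 21; 19; 8; 13; 20; 15; 0; 3; 14; 17; 16; 18; 4; 9; 6; 11; 10; 12; 2; 5; 1];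
    [:: 10; 7; 12; 20; 6; 21; 4; 1; 13; 16; 0; 18; 2; 8; 17; 19; 9; 14; 11; 15; 3; 5];
    [:: 10; 19; 16; 21; 20; 17; 14; 12; 18; 15; 0; 13; 7; 11; 6; 9; 2; 5; 8; 1; 4; 3];
    [:: 17; 14; 5; 13; 15; 2; 21; 16; 19; 11; 20; 9; 18; 3; 1; 4; 7; 0; 12; 8; 10; 6];
    [:: 19; 6; 9; 18; 11; 20; 1; 12; 14; 2; 16; 4; 7; 15; 8; 13; 10; 21; 3; 0; 5; 17];
    [:: 14; 18; 5; 17; 19; 2; 21; 13; 10; 15; 8; 16; 20; 7; 0; 9; 11; 3; 1; 4; 12; 6]].

(** Orders that keep the number of edges between processed and unprocessed
    vertices small, hence also the number of states. *)
Definition vertex_orders : seq (seq nat) :=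
  [:: [:: 0; 1; 21; 7; 2; 20; 19; 6; 5; 8; 3; 4; 18; 15; 9; 14; 13; 12; 17; 16; 10; 11];
    [:: 17; 14; 16; 15; 18; 19; 13; 9; 8; 11; 12; 10; 20; 7; 2; 3; 1; 0; 21; 6; 4; 5];
    [:: 3; 2; 4; 21; 20; 1; 0; 19; 16; 5; 17; 18; 10; 15; 9; 8; 6; 14; 7; 11; 13; 12];
    [:: 4; 3; 5; 2; 15; 13; 14; 1; 6; 16; 7; 12; 0; 21; 17; 18; 8; 19; 20; 11; 9; 10];
    [:: 19; 0; 18; 20; 21; 17; 1; 3; 2; 5; 6; 4; 16; 9; 10; 11; 7; 8; 12; 15; 14; 13];
    [:: 4; 3; 5; 2; 19; 17; 18; 1; 6; 20; 21; 0; 16; 7; 12; 11; 13; 14; 15; 8; 10; 9]].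

Definition triangles : seq (nat * nat * nat) :=
  [:: (0, 1, 21);
    (4, 5, 6);
    (11, 12, 13);
    (9, 10, 11);
    (13, 14, 15);
    (8, 9, 10)].

Definition colourings : seq (seq nat) :=
  [:: [:: 0; 1; 0; 1; 0; 1; 0; 1; 0; 1; 0; 1; 0; 1; 0; 1; 0; 1; 2; 1; 0; 2];
    [:: 0; 1; 0; 1; 0; 1; 2; 0; 1; 0; 1; 0; 1; 0; 1; 0; 1; 0; 1; 2; 0; 2];
    [:: 0; 1; 0; 1; 0; 1; 0; 1; 0; 1; 2; 0; 2; 1; 2; 0; 1; 0; 1; 0; 1; 2];
    [:: 0; 1; 0; 1; 0; 1; 0; 1; 0; 1; 0; 2; 0; 2; 0; 1; 0; 1; 2; 1; 2; 1];
    [:: 0; 1; 0; 1; 0; 1; 0; 1; 0; 1; 0; 1; 0; 1; 2; 0; 1; 0; 2; 1; 0; 1];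
    [:: 0; 1; 0; 1; 0; 1; 0; 1; 0; 1; 2; 0; 1; 0; 1; 0; 1; 0; 2; 1; 0; 1]].

Definition stable_sets : seq (seq nat) :=
  [:: [:: 0; 2; 4; 6; 8; 10; 12; 14; 16; 20];
    [:: 0; 2; 4; 7; 9; 11; 13; 15; 17; 20];
    [:: 0; 3; 5; 7; 9; 11; 14; 16; 18; 20];
    [:: 0; 2; 4; 6; 8; 11; 13; 16; 18; 20];
    [:: 0; 2; 4; 6; 8; 10; 12; 15; 17; 20];
    [:: 0; 2; 4; 6; 8; 11; 13; 15; 17; 20]].

(** A triangle, a pentagon and seven edges: at most 1 + 2 + 7 = 10 stable
    vertices. *)
Definition cycle_covers : seq (seq (seq nat)) :=
  [:: [:: [:: 0; 1; 21]; [:: 10; 11; 12; 18; 17]; [:: 2; 3]; [:: 4; 5]; [:: 6; 7]; [:: 8; 9]; [:: 13; 14]; [:: 15; 16]; [:: 19; 20]];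
    [:: [:: 4; 5; 6]; [:: 14; 15; 19; 18; 17]; [:: 0; 1]; [:: 2; 3]; [:: 7; 8]; [:: 9; 16]; [:: 10; 11]; [:: 12; 13]; [:: 20; 21]];
    [:: [:: 11; 12; 13]; [:: 0; 1; 2; 3; 21]; [:: 4; 5]; [:: 6; 7]; [:: 8; 18]; [:: 9; 10]; [:: 14; 15]; [:: 16; 17]; [:: 19; 20]];
    [:: [:: 9; 10; 11]; [:: 1; 2; 3; 13; 14]; [:: 0; 21]; [:: 4; 15]; [:: 5; 6]; [:: 7; 8]; [:: 12; 18]; [:: 16; 17]; [:: 19; 20]];
    [:: [:: 13; 14; 15]; [:: 0; 19; 18; 17; 21]; [:: 1; 2]; [:: 3; 4]; [:: 5; 20]; [:: 6; 7]; [:: 8; 9]; [:: 10; 16]; [:: 11; 12]];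
    [:: [:: 8; 9; 10]; [:: 1; 2; 3; 17; 18]; [:: 0; 21]; [:: 4; 5]; [:: 6; 7]; [:: 11; 12]; [:: 13; 14]; [:: 15; 16]; [:: 19; 20]]].

Definition dominating_sets : seq (seq nat) :=
  [:: [:: 0; 2; 5; 9; 12; 16];
    [:: 0; 3; 6; 13; 16; 18];
    [:: 1; 21; 5; 8; 11; 15];
    [:: 0; 3; 6; 19; 11; 15];
    [:: 0; 3; 5; 8; 16; 12];
    [:: 1; 4; 21; 8; 16; 13]].

(** The k-th entry is the number of rotation systems with k faces. *)
Definition genus_tables : seq (seq N) :=
  [:: [:: 0; 593920; 0; 2607616; 0; 934272; 0; 57792; 0; 704]%bin;
    [:: 0; 589824; 0; 2610176; 0; 935744; 0; 58032; 0; 528]%bin;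
    [:: 0; 608256; 0; 2603328; 0; 921008; 0; 60960; 0; 752]%bin;
    [:: 0; 620544; 0; 2594304; 0; 916416; 0; 62224; 0; 816]%bin;
    [:: 0; 598016; 0; 2604544; 0; 932672; 0; 58384; 0; 688]%bin;
    [:: 0; 604160; 0; 2607168; 0; 921520; 0; 60720; 0; 736]%bin].

(** The i-th entry relates the i-th graph to the next one.  Each is a 0/1 matrix
    with three ones per row, given by the supports of its rows. *)
Definition intertwiners : seq (seq (seq nat)) :=
  [:: [:: [:: 2; 4; 8];
      [:: 3; 5; 7];
      [:: 4; 6; 20];
      [:: 5; 19; 21];
      [:: 0; 1; 20];
      [:: 0; 2; 21];
      [:: 1; 7; 21];
      [:: 0; 6; 8];
      [:: 7; 9; 15];
      [:: 8; 10; 14];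
      [:: 3; 9; 13];
      [:: 4; 12; 14];
      [:: 5; 13; 15];
      [:: 6; 14; 16];
      [:: 11; 15; 17];
      [:: 10; 16; 18];
      [:: 9; 11; 17];
      [:: 10; 12; 16];
      [:: 11; 13; 18];
      [:: 12; 17; 19];
      [:: 2; 18; 20];
      [:: 1; 3; 19]];
    [:: [:: 15; 18; 20];
      [:: 11; 17; 19];
      [:: 12; 14; 18];
      [:: 13; 15; 17];
      [:: 8; 14; 16];
      [:: 7; 9; 13];
      [:: 1; 6; 8];
      [:: 0; 5; 7];
      [:: 1; 10; 21];
      [:: 0; 2; 20];
      [:: 3; 19; 21];
      [:: 4; 5; 20];
      [:: 4; 6; 21];
      [:: 3; 5; 6];
      [:: 2; 4; 7];
      [:: 1; 3; 12];
      [:: 2; 11; 13];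
      [:: 8; 10; 12];
      [:: 0; 9; 11];
      [:: 10; 16; 18];
      [:: 9; 15; 17];
      [:: 14; 16; 19]];
    [:: [:: 2; 15; 17];
      [:: 1; 3; 16];
      [:: 2; 4; 21];
      [:: 0; 3; 20];
      [:: 4; 19; 21];
      [:: 3; 5; 20];
      [:: 4; 6; 17];
      [:: 5; 7; 18];
      [:: 6; 8; 12];
      [:: 7; 11; 13];
      [:: 11; 12; 14];
      [:: 10; 12; 13];
      [:: 0; 9; 11];
      [:: 1; 10; 21];
      [:: 0; 2; 19];
      [:: 1; 18; 20];
      [:: 8; 17; 19];
      [:: 9; 16; 18];
      [:: 8; 10; 15];
      [:: 7; 9; 14];
      [:: 6; 13; 15];
      [:: 5; 14; 16]];
    [:: [:: 3; 5; 15];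
      [:: 4; 6; 16];
      [:: 7; 15; 17];
      [:: 0; 14; 16];
      [:: 1; 17; 21];
      [:: 0; 2; 6];
      [:: 5; 7; 21];
      [:: 6; 8; 20];
      [:: 7; 9; 19];
      [:: 8; 16; 18];
      [:: 12; 17; 19];
      [:: 0; 18; 20];
      [:: 10; 19; 21];
      [:: 9; 11; 20];
      [:: 8; 10; 11];
      [:: 9; 10; 12];
      [:: 11; 13; 18];
      [:: 3; 12; 14];
      [:: 1; 13; 15];
      [:: 2; 4; 14];
      [:: 1; 3; 5];
      [:: 2; 4; 13]];
    [:: [:: 3; 5; 11];
      [:: 4; 18; 20];
      [:: 5; 19; 21];
      [:: 0; 17; 20];
      [:: 1; 19; 21];
      [:: 0; 6; 20];
      [:: 1; 5; 7];
      [:: 6; 8; 12];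
      [:: 7; 13; 14];
      [:: 12; 14; 15];
      [:: 8; 13; 15];
      [:: 9; 14; 16];
      [:: 2; 8; 10];
      [:: 7; 9; 11];
      [:: 4; 10; 12];
      [:: 11; 13; 16];
      [:: 10; 15; 17];
      [:: 16; 18; 21];
      [:: 3; 17; 19];
      [:: 0; 2; 18];
      [:: 1; 3; 9];
      [:: 2; 4; 6]]].

(** Their inverses modulo 5. *)
Definition inverses : seq (seq (seq nat)) :=
  [:: [:: [:: 2; 4; 2; 3; 0; 0; 2; 1; 4; 2; 3; 1; 3; 2; 3; 3; 3; 0; 4; 4; 3; 3];
      [:: 3; 0; 3; 2; 3; 3; 0; 4; 0; 3; 2; 4; 3; 3; 2; 1; 3; 1; 0; 0; 4; 3];
      [:: 0; 1; 0; 4; 2; 3; 3; 0; 1; 0; 4; 0; 0; 0; 4; 1; 0; 4; 1; 1; 3; 0];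
      [:: 3; 3; 3; 0; 3; 3; 2; 4; 0; 3; 3; 4; 2; 3; 3; 1; 2; 1; 0; 0; 4; 0];
      [:: 4; 1; 4; 2; 0; 0; 3; 0; 1; 1; 2; 3; 2; 1; 2; 3; 2; 1; 1; 1; 1; 2];
      [:: 3; 3; 3; 0; 3; 3; 2; 4; 0; 3; 2; 4; 3; 3; 2; 1; 3; 1; 0; 0; 4; 0];
      [:: 1; 3; 2; 3; 2; 3; 4; 0; 3; 4; 3; 2; 4; 4; 3; 1; 4; 0; 3; 3; 1; 4];
      [:: 4; 0; 4; 0; 4; 4; 1; 2; 0; 4; 0; 2; 0; 4; 0; 3; 0; 3; 0; 0; 2; 0];
      [:: 2; 3; 1; 4; 3; 2; 4; 0; 3; 4; 4; 2; 3; 4; 4; 1; 3; 0; 3; 3; 1; 3];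
      [:: 3; 0; 3; 0; 3; 3; 2; 4; 3; 3; 0; 4; 0; 3; 2; 1; 3; 1; 0; 0; 4; 0];
      [:: 2; 1; 3; 4; 2; 3; 3; 0; 1; 3; 4; 0; 0; 2; 4; 4; 0; 4; 1; 1; 0; 0];
      [:: 1; 0; 1; 4; 1; 1; 0; 3; 0; 1; 1; 3; 1; 1; 4; 4; 4; 0; 3; 2; 3; 4];
      [:: 0; 3; 0; 1; 0; 0; 4; 0; 3; 0; 1; 0; 1; 0; 1; 2; 1; 3; 3; 3; 0; 1];
      [:: 4; 2; 4; 0; 4; 4; 1; 2; 2; 4; 3; 2; 3; 4; 0; 3; 0; 3; 0; 0; 2; 0];
      [:: 1; 1; 1; 2; 0; 0; 3; 0; 1; 4; 2; 3; 2; 4; 2; 0; 2; 1; 1; 1; 4; 2];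
      [:: 3; 0; 3; 0; 3; 3; 2; 4; 3; 3; 0; 4; 0; 3; 3; 1; 2; 1; 0; 0; 4; 0];
      [:: 3; 1; 2; 0; 3; 2; 3; 0; 1; 2; 0; 0; 4; 3; 0; 4; 4; 4; 1; 1; 0; 4];
      [:: 1; 0; 1; 1; 1; 1; 3; 3; 2; 1; 4; 3; 4; 1; 4; 0; 4; 4; 2; 3; 3; 1];
      [:: 0; 3; 0; 1; 0; 0; 4; 0; 3; 0; 1; 0; 1; 0; 1; 3; 1; 2; 3; 3; 0; 1];
      [:: 4; 2; 4; 3; 4; 4; 3; 2; 0; 4; 0; 2; 0; 4; 0; 3; 0; 3; 0; 0; 2; 3];
      [:: 0; 1; 0; 0; 3; 2; 3; 0; 1; 0; 0; 0; 4; 0; 0; 1; 4; 4; 1; 1; 3; 4];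
      [:: 3; 0; 3; 3; 3; 3; 0; 4; 0; 3; 3; 4; 2; 3; 3; 1; 2; 1; 0; 0; 4; 2]];
    [:: [:: 0; 0; 0; 3; 4; 0; 4; 0; 3; 3; 4; 2; 3; 3; 0; 3; 2; 2; 3; 0; 2; 1];
      [:: 3; 3; 1; 1; 4; 3; 0; 1; 3; 3; 2; 4; 0; 0; 1; 3; 1; 1; 1; 1; 1; 0];
      [:: 0; 0; 0; 2; 4; 0; 4; 0; 3; 3; 4; 2; 3; 3; 0; 3; 3; 2; 2; 0; 3; 1];
      [:: 1; 1; 2; 0; 2; 1; 0; 4; 0; 1; 3; 3; 2; 3; 0; 0; 4; 3; 0; 2; 4; 1];
      [:: 0; 0; 0; 3; 4; 0; 4; 2; 3; 0; 4; 0; 3; 3; 3; 3; 2; 2; 3; 0; 2; 1];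
      [:: 0; 0; 0; 2; 4; 0; 4; 3; 3; 0; 4; 0; 3; 3; 2; 3; 3; 2; 2; 0; 3; 1];
      [:: 4; 4; 3; 3; 4; 4; 1; 3; 2; 4; 3; 2; 0; 0; 3; 2; 3; 0; 3; 3; 3; 3];
      [:: 0; 0; 0; 0; 2; 0; 2; 3; 4; 2; 2; 3; 4; 4; 3; 4; 0; 1; 0; 0; 0; 3];
      [:: 3; 3; 1; 1; 2; 3; 0; 1; 0; 3; 0; 4; 0; 0; 1; 0; 1; 4; 1; 1; 1; 2];
      [:: 0; 0; 0; 2; 4; 3; 4; 1; 3; 4; 4; 1; 3; 3; 1; 3; 0; 2; 0; 0; 3; 1];
      [:: 1; 1; 2; 0; 4; 1; 0; 4; 3; 1; 0; 3; 2; 3; 0; 2; 4; 1; 0; 2; 4; 4];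
      [:: 0; 0; 0; 0; 2; 2; 2; 4; 4; 3; 2; 2; 4; 4; 4; 4; 3; 1; 3; 0; 0; 3];
      [:: 1; 1; 2; 4; 4; 1; 0; 0; 2; 1; 0; 3; 3; 2; 4; 3; 0; 1; 4; 2; 0; 4];
      [:: 0; 0; 0; 3; 4; 3; 4; 1; 3; 4; 4; 1; 3; 3; 1; 3; 0; 2; 0; 0; 2; 1];
      [:: 1; 1; 0; 0; 2; 1; 0; 4; 3; 1; 0; 3; 2; 3; 0; 2; 4; 3; 0; 4; 4; 4];
      [:: 3; 2; 1; 4; 4; 2; 3; 4; 1; 2; 3; 0; 1; 1; 4; 1; 4; 3; 4; 1; 4; 0];
      [:: 1; 1; 4; 4; 2; 1; 0; 0; 2; 1; 0; 3; 3; 2; 4; 3; 0; 3; 4; 0; 0; 4];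
      [:: 2; 3; 4; 4; 2; 0; 3; 0; 1; 4; 3; 4; 1; 1; 0; 1; 1; 0; 1; 4; 4; 4];
      [:: 3; 3; 4; 1; 4; 3; 0; 1; 0; 3; 0; 4; 0; 0; 1; 0; 1; 1; 1; 4; 1; 2];
      [:: 3; 3; 1; 1; 1; 3; 0; 1; 0; 3; 0; 4; 0; 0; 1; 0; 1; 4; 1; 1; 1; 3];
      [:: 0; 0; 0; 0; 2; 0; 2; 0; 4; 0; 2; 1; 4; 4; 0; 4; 0; 1; 0; 0; 0; 3];
      [:: 1; 1; 2; 4; 2; 1; 0; 0; 0; 1; 3; 3; 3; 2; 4; 0; 0; 3; 4; 2; 0; 1]];
    [:: [:: 1; 1; 1; 3; 1; 1; 3; 2; 1; 0; 0; 4; 0; 3; 3; 1; 1; 2; 3; 3; 1; 2];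
      [:: 1; 4; 1; 2; 1; 4; 3; 3; 1; 0; 0; 4; 0; 3; 3; 4; 1; 3; 3; 2; 1; 3];
      [:: 2; 2; 0; 1; 4; 2; 1; 4; 2; 0; 0; 3; 0; 1; 4; 2; 2; 4; 1; 1; 2; 4];
      [:: 4; 0; 0; 4; 4; 2; 1; 2; 4; 2; 3; 3; 0; 1; 1; 4; 0; 4; 1; 1; 0; 1];
      [:: 4; 2; 2; 4; 2; 4; 2; 3; 4; 4; 4; 2; 2; 1; 4; 2; 4; 0; 2; 3; 4; 3];
      [:: 1; 1; 1; 2; 1; 2; 3; 2; 1; 0; 0; 4; 0; 3; 3; 1; 1; 2; 3; 3; 1; 2];
      [:: 0; 0; 0; 3; 0; 2; 0; 4; 3; 4; 4; 3; 2; 0; 0; 0; 0; 1; 2; 2; 3; 4];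
      [:: 0; 2; 4; 4; 0; 4; 1; 3; 0; 3; 2; 3; 0; 1; 1; 2; 4; 0; 1; 0; 4; 3];
      [:: 2; 0; 3; 1; 2; 4; 0; 3; 0; 3; 3; 2; 4; 0; 0; 0; 3; 2; 3; 4; 0; 3];
      [:: 1; 1; 1; 2; 1; 2; 3; 4; 1; 0; 0; 4; 0; 3; 3; 1; 1; 0; 3; 1; 1; 4];
      [:: 0; 0; 0; 3; 0; 2; 0; 4; 0; 4; 4; 1; 2; 0; 0; 0; 0; 1; 0; 2; 0; 4];
      [:: 3; 3; 3; 0; 3; 2; 4; 4; 3; 0; 0; 2; 1; 4; 4; 3; 3; 3; 4; 1; 3; 4];
      [:: 3; 0; 2; 1; 3; 4; 0; 3; 3; 3; 3; 0; 4; 0; 0; 0; 2; 2; 0; 4; 2; 3];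
      [:: 2; 0; 3; 1; 2; 4; 0; 3; 2; 3; 3; 0; 4; 0; 0; 0; 3; 2; 0; 4; 3; 3];
      [:: 4; 2; 0; 4; 4; 4; 1; 3; 4; 2; 3; 3; 0; 1; 1; 2; 0; 0; 1; 0; 0; 3];
      [:: 3; 0; 2; 1; 3; 4; 0; 3; 0; 3; 3; 2; 4; 0; 0; 0; 2; 2; 3; 4; 0; 3];
      [:: 0; 2; 4; 4; 0; 4; 1; 0; 0; 3; 2; 3; 0; 1; 1; 2; 4; 3; 1; 2; 4; 1];
      [:: 1; 3; 3; 3; 3; 4; 4; 3; 3; 2; 2; 0; 1; 4; 1; 3; 1; 4; 1; 0; 3; 3];
      [:: 4; 2; 0; 4; 4; 4; 1; 1; 4; 2; 3; 3; 0; 1; 1; 2; 0; 3; 1; 2; 0; 0];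
      [:: 2; 2; 4; 1; 0; 2; 1; 4; 2; 0; 0; 3; 0; 1; 4; 2; 2; 4; 1; 1; 2; 4];
      [:: 0; 4; 4; 4; 0; 2; 1; 1; 0; 3; 2; 3; 0; 1; 1; 0; 4; 4; 1; 1; 4; 2];
      [:: 4; 1; 4; 0; 4; 4; 2; 3; 4; 1; 1; 0; 3; 3; 2; 1; 4; 1; 2; 1; 4; 3]];
    [:: [:: 0; 0; 4; 3; 0; 0; 1; 0; 0; 2; 1; 3; 4; 2; 3; 3; 0; 1; 1; 1; 4; 4];
      [:: 4; 0; 2; 0; 2; 0; 1; 0; 2; 0; 1; 0; 2; 0; 0; 3; 0; 1; 4; 4; 0; 1];
      [:: 4; 2; 0; 0; 4; 3; 1; 0; 4; 3; 1; 2; 0; 3; 2; 3; 0; 1; 1; 4; 0; 4];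
      [:: 4; 1; 4; 3; 4; 1; 2; 3; 4; 1; 2; 1; 4; 1; 1; 0; 3; 3; 2; 4; 4; 0];
      [:: 0; 3; 4; 0; 0; 2; 1; 0; 0; 2; 1; 3; 4; 2; 3; 3; 0; 1; 1; 4; 4; 4];
      [:: 2; 4; 4; 2; 4; 4; 2; 2; 4; 4; 2; 4; 4; 4; 4; 2; 2; 1; 4; 2; 2; 4];
      [:: 1; 3; 1; 2; 1; 3; 3; 0; 1; 0; 3; 0; 1; 0; 0; 4; 0; 3; 3; 0; 1; 2];
      [:: 1; 3; 1; 4; 0; 3; 2; 4; 3; 3; 4; 3; 3; 3; 3; 4; 4; 2; 3; 4; 2; 3];
      [:: 0; 1; 4; 4; 0; 1; 1; 3; 0; 0; 1; 0; 4; 2; 3; 3; 0; 1; 1; 0; 4; 4];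
      [:: 3; 3; 2; 4; 3; 3; 0; 4; 3; 3; 0; 3; 2; 3; 3; 0; 4; 0; 0; 1; 2; 1];
      [:: 2; 3; 3; 4; 2; 3; 0; 4; 2; 3; 0; 3; 3; 3; 3; 0; 4; 0; 0; 1; 3; 1];
      [:: 3; 1; 3; 2; 3; 1; 4; 3; 3; 2; 4; 2; 3; 0; 0; 2; 1; 4; 4; 4; 3; 0];
      [:: 0; 4; 0; 2; 0; 4; 0; 2; 0; 4; 0; 4; 0; 4; 4; 1; 2; 0; 0; 3; 0; 3];
      [:: 1; 0; 1; 0; 1; 0; 3; 0; 1; 0; 3; 0; 1; 0; 0; 4; 0; 3; 3; 2; 1; 3];
      [:: 1; 0; 1; 0; 1; 0; 3; 0; 1; 0; 3; 0; 1; 0; 0; 4; 0; 3; 3; 3; 1; 2];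
      [:: 0; 0; 2; 0; 2; 0; 1; 0; 2; 0; 1; 0; 2; 0; 0; 3; 0; 1; 4; 4; 4; 1];
      [:: 4; 0; 0; 3; 4; 0; 1; 0; 4; 3; 1; 2; 0; 3; 2; 3; 0; 1; 1; 1; 0; 4];
      [:: 4; 2; 3; 1; 3; 2; 2; 1; 0; 2; 0; 2; 0; 2; 2; 3; 1; 2; 3; 2; 4; 1];
      [:: 1; 4; 1; 3; 1; 4; 3; 2; 1; 3; 3; 3; 1; 0; 0; 4; 0; 3; 3; 4; 1; 2];
      [:: 1; 4; 2; 2; 2; 4; 3; 2; 0; 4; 1; 4; 0; 4; 4; 1; 2; 3; 2; 0; 1; 1];
      [:: 4; 1; 0; 4; 4; 1; 1; 3; 4; 0; 1; 0; 0; 3; 2; 3; 0; 1; 1; 0; 0; 4];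
      [:: 2; 3; 0; 4; 1; 3; 2; 4; 3; 3; 4; 3; 3; 3; 3; 4; 4; 2; 3; 4; 1; 3]];
    [:: [:: 0; 4; 4; 4; 0; 2; 1; 0; 3; 2; 3; 0; 2; 1; 3; 4; 0; 1; 1; 0; 4; 3];
      [:: 0; 0; 2; 1; 3; 4; 3; 4; 2; 3; 3; 0; 3; 0; 3; 0; 4; 0; 0; 0; 0; 2];
      [:: 4; 2; 0; 4; 4; 4; 1; 0; 3; 3; 2; 4; 3; 1; 2; 0; 0; 1; 1; 2; 0; 1];
      [:: 3; 0; 0; 3; 0; 2; 2; 2; 1; 4; 4; 0; 4; 2; 4; 0; 2; 0; 0; 0; 3; 1];
      [:: 0; 2; 4; 4; 0; 4; 1; 0; 3; 2; 3; 0; 2; 1; 3; 4; 0; 1; 1; 2; 4; 1];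
      [:: 0; 0; 3; 1; 2; 4; 3; 4; 2; 3; 3; 0; 3; 0; 3; 0; 4; 0; 0; 0; 0; 2];
      [:: 1; 1; 1; 2; 1; 2; 3; 0; 4; 0; 0; 1; 0; 3; 0; 1; 0; 3; 3; 1; 1; 4];
      [:: 0; 0; 0; 3; 0; 2; 0; 2; 1; 4; 4; 0; 4; 0; 4; 0; 2; 0; 0; 0; 0; 1];
      [:: 0; 2; 4; 4; 0; 4; 1; 3; 3; 2; 3; 0; 0; 1; 0; 4; 0; 1; 1; 2; 4; 3];
      [:: 2; 0; 3; 1; 2; 4; 0; 4; 2; 3; 3; 0; 3; 3; 3; 0; 4; 0; 0; 0; 3; 2];
      [:: 1; 1; 1; 2; 1; 2; 3; 2; 4; 0; 0; 1; 3; 3; 3; 1; 0; 3; 3; 1; 1; 1];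
      [:: 3; 0; 2; 1; 3; 4; 0; 4; 2; 3; 3; 0; 3; 3; 3; 0; 4; 0; 0; 0; 2; 2];
      [:: 4; 2; 0; 4; 4; 4; 1; 3; 3; 3; 2; 4; 0; 1; 0; 0; 0; 1; 1; 2; 0; 3];
      [:: 2; 0; 3; 1; 2; 4; 0; 4; 0; 3; 3; 2; 3; 0; 3; 3; 4; 0; 0; 0; 3; 2];
      [:: 3; 0; 2; 1; 3; 4; 0; 4; 0; 3; 3; 3; 3; 0; 3; 2; 4; 0; 0; 0; 2; 2];
      [:: 3; 3; 3; 0; 3; 2; 4; 3; 2; 0; 0; 3; 2; 4; 2; 3; 1; 4; 4; 3; 3; 0];
      [:: 0; 0; 0; 3; 0; 2; 0; 2; 3; 4; 4; 3; 4; 2; 4; 3; 2; 0; 0; 0; 0; 1];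
      [:: 1; 1; 1; 3; 1; 1; 3; 0; 4; 0; 0; 1; 0; 3; 0; 1; 0; 3; 3; 1; 1; 4];
      [:: 1; 4; 1; 2; 1; 4; 3; 0; 4; 0; 0; 1; 0; 3; 0; 1; 0; 3; 3; 4; 1; 1];
      [:: 1; 4; 4; 4; 4; 2; 0; 3; 0; 1; 1; 4; 1; 0; 1; 4; 3; 2; 3; 4; 1; 0];
      [:: 4; 0; 0; 4; 4; 2; 1; 0; 3; 3; 2; 4; 3; 1; 2; 0; 0; 1; 1; 4; 0; 3];
      [:: 4; 1; 4; 0; 4; 4; 2; 3; 3; 1; 1; 1; 1; 0; 1; 1; 3; 3; 2; 1; 4; 3]]].

Definition graph (i : nat) : seq (seq nat) :=
  [seq [:: j.+1 %% 22; (j + 21) %% 22; nth 0 (nth [::] chords i) j]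
     | j <- iota 0 22].

Definition vertex_order (i : nat) : seq nat := nth [::] vertex_orders i.

(** Each edge is listed with its later end, so that a vertex is finished as soon
    as its last neighbour is processed. *)
Definition frontier_edges (i : nat) : seq (nat * nat) :=
  let vs := vertex_order i in
  flatten [seq [seq ordered u v | u <- nth [::] (graph i) v
                               & index u vs < index v vs] | v <- vs].

(** The Hamiltonian cycle has even length: two colours alternate along it and
    the chords take the third. *)
Definition lcf_edge_colour (j k : nat) : nat :=
  if k == j.+1 %% 22 then nat_of_bool (odd j)
  else if j == k.+1 %% 22 then nat_of_bool (odd k) else 2.

Lemma all_upto (N : nat) (P : pred nat) :
  all P (iota 0 N) -> forall i, i < N -> P i.
Proof. by move=> /allP ok i lti; apply: ok; rewrite mem_iota. Qed.

Lemma graph_cubic i : i < 6 -> cubic_lists 21 (graph i).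
Proof. by move: i; apply: all_upto; vm_compute. Qed.

Lemma vertex_order_perm i : i < 6 -> perm_eq (vertex_order i) (iota 0 22).
Proof. by move: i; apply: all_upto; vm_compute. Qed.

Lemma genus_table i : i < 6 ->
  face_distribution (nth [::] (graph i)) (vertex_order i) =
  nth [::] genus_tables i.
Proof. by move=> lti; apply/eqP; move: i lti; apply: all_upto; vm_compute. Qed.

Section OneGraph.
Variable i : nat.
Hypothesis lti : i < 6.
Let G := lgraph 21 (graph i).
Let cub : cubic_lists 21 (graph i) := graph_cubic lti.

Lemma graph_connected : is_connected G.
Proof.
apply: (lgraph_connected cub (k := 8)).
by move: i lti; apply: all_upto; vm_compute.
Qed.

Lemma graph_girth : girth G = 3.
Proof.
pose t := nth (0, 0, 0) triangles i.
apply: (girth_lgraph cub (a := t.1.1) (b := t.1.2) (c := t.2)) => //.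
by rewrite /t; move: i lti; apply: all_upto; vm_compute.
Qed.

Lemma graph_diameter : diameter G = 5.
Proof.
rewrite (diameter_ecc cub); apply/eqP.
by move: i lti; apply: all_upto; vm_compute.
Qed.

Lemma graph_radius : radius G = 4.
Proof.
rewrite (radius_ecc cub); apply/eqP.
by move: i lti; apply: all_upto; vm_compute.
Qed.

Lemma graph_vertex_connectivity : vertex_connectivity G = 3.
Proof.
(* Eight rounds reach every vertex, whichever two are deleted. *)
apply: (vertex_connectivity3 cub (k := 8)) => //;
  by move: i lti; apply: all_upto; vm_compute.
Qed.

Lemma graph_edge_connectivity : edge_connectivity G = 3.
Proof.
apply: (edge_connectivity3 cub (k := 8));
  by move: i lti; apply: all_upto; vm_compute.
Qed.

Lemma graph_edges : graph_size G = 33.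
Proof.
rewrite (lgraph_size cub); apply/eqP.
by move: i lti; apply: all_upto; vm_compute.
Qed.

Lemma graph_aut_order : aut_order G = 2.
Proof.
rewrite (aut_order_iso_maps cub (vertex_order_perm lti)); apply/eqP.
by move: i lti; apply: all_upto; vm_compute.
Qed.

Lemma graph_chromatic_number : chromatic_number G = 3.
Proof.
pose t := nth (0, 0, 0) triangles i.
apply: (chromatic_number_lgraph cub (a := t.1.1) (b := t.1.2) (c := t.2) _
          (col := nth [::] colourings i)) => //;
  by rewrite /t; move: i lti; apply: all_upto; vm_compute.
Qed.

Lemma graph_chromatic_index : chromatic_index G = 3.
Proof.
apply: (chromatic_index_lgraph cub (c := lcf_edge_colour)).
by move: i lti; apply: all_upto; vm_compute.
Qed.

Lemma graph_domination_number : domination_number G = 6.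
Proof.
have sz : size (nth [::] dominating_sets i) = 6.
  by apply/eqP; move: i lti; apply: all_upto; vm_compute.
rewrite -sz; apply: (domination_number_lgraph cub); rewrite ?sz //.
- by move: i lti; apply: all_upto; vm_compute.
- by apply/allP; move: i lti; apply: all_upto; vm_compute.
by move: i lti; apply: all_upto; vm_compute.
Qed.

Lemma graph_independence_number : independence_number G = 10.
Proof.
have sz : size (nth [::] stable_sets i) = 10.
  by apply/eqP; move: i lti; apply: all_upto; vm_compute.
rewrite -sz; apply: (independence_number_lgraph cub (cs := nth [::] cycle_covers i));
  last (apply/eqP); by move: i lti; apply: all_upto; vm_compute.
Qed.

Lemma graph_matching_number : matching_number G = 11.
Proof.
rewrite -[11]/(size [seq (j.*2, j.*2.+1) | j <- iota 0 11]).
apply: (matching_number_lgraph cub) => //; apply/allP.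
by move: i lti; apply: all_upto; vm_compute.
Qed.

Lemma graph_clique_number : clique_number G = 3.
Proof.
pose t := nth (0, 0, 0) triangles i.
apply: (clique_number_lgraph cub (a := t.1.1) (b := t.1.2) (c := t.2));
  by rewrite /t; move: i lti; apply: all_upto; vm_compute.
Qed.

Lemma graph_circumference : circumference G = 22.
Proof.
by apply: hamiltonian_circumference_lgraph.
Qed.

(** The value stays in binary: its unary form has over twenty million
    constructors. *)
Lemma graph_spanning_trees :
  spanning_tree_count G = N.to_nat 20923360%bin.
Proof.
have treesE : tree_count 22 (frontier_edges i) = 20923360%bin.
  by apply/eqP; move: i lti; apply: all_upto; vm_compute.
rewrite (lgraph_spanning_trees (es := frontier_edges i) cub) ?treesE //.
by move: i lti; apply: all_upto; vm_compute.
Qed.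

Lemma graph_genus_number g :
  genus_number G g =
    N.to_nat (total_weight (fun k => (13 - k)./2 == g) (nth [::] genus_tables i)).
Proof. by rewrite (genus_number22 g cub (vertex_order_perm lti)) genus_table. Qed.

Lemma graph_min_genus : min_genus G = 2.
Proof.
apply: min_genus_eq => [||g]; first by rewrite card_ord.
  rewrite graph_genus_number.
  suff : total_weight (fun k => (13 - k)./2 == 2) (nth [::] genus_tables i) != 0%bin.
    by apply: contra => /eqP; rewrite -[0]/(N.to_nat 0%bin) => /N2Nat.inj ->.
  by move: i lti; apply: all_upto; vm_compute.
rewrite graph_genus_number => lt2.
suff -> : total_weight (fun k => (13 - k)./2 == g) (nth [::] genus_tables i) = 0%bin by [].
apply/eqP; case: g lt2 => [|[|g]] // _;
  by move: i lti; apply: all_upto; vm_compute.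
Qed.

End OneGraph.

Lemma graph_spectra_step i : i < 5 ->
  spectrum (adjacency_mx (lgraph 21 (graph i))) =
    spectrum (adjacency_mx (lgraph 21 (graph i.+1))) /\
  spectrum (laplacian_mx (lgraph 21 (graph i))) =
    spectrum (laplacian_mx (lgraph 21 (graph i.+1))).
Proof.
move=> lti.
apply: (@intertwined_spectra 21 _ _ _ _ 5 (nth [::] intertwiners i)
          (nth [::] inverses i)) => //.
- by apply: graph_cubic; apply: ltnW.
- exact: graph_cubic.
- by move: i lti; apply: all_upto; vm_compute.
by move: i lti; apply: all_upto; vm_compute.
Qed.

Lemma graph_spectra i : i < 6 ->
  spectrum (adjacency_mx (lgraph 21 (graph i))) =
    spectrum (adjacency_mx (lgraph 21 (graph 0))) /\
  spectrum (laplacian_mx (lgraph 21 (graph i))) =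
    spectrum (laplacian_mx (lgraph 21 (graph 0))).
Proof.
elim: i => [//|i IH] lti; have [<- <-] := graph_spectra_step lti.
by apply: IH; apply: ltnW.
Qed.

(** Genus 6 is the maximum, attained by the embeddings with a single face; their
    numbers alone distinguish the six graphs. *)
Definition one_face (i : nat) : N :=
  total_weight (fun c => (13 - c)./2 == 6) (nth [::] genus_tables i).

Lemma genus_poly_one_face i : i < 6 ->
  ((genus_poly (lgraph 21 (graph i)))`_6 = (N.to_nat (one_face i))%:R)%R.
Proof. by move=> lti; rewrite genus_poly_coef (graph_genus_number lti). Qed.

Lemma genus_poly_inj i j : i < 6 -> j < 6 ->
  genus_poly (lgraph 21 (graph i)) = genus_poly (lgraph 21 (graph j)) -> i = j.
Proof.
move=> lti ltj E; have {}E : one_face i = one_face j.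
  apply: N2Nat.inj; apply/eqP; rewrite -(Num.Theory.eqr_nat int).
  by rewrite -(genus_poly_one_face lti) -(genus_poly_one_face ltj) E.
have un : uniq [seq one_face k | k <- iota 0 6] by vm_compute.
apply/eqP; rewrite -(nth_uniq 0%bin (s := [seq one_face k | k <- iota 0 6])) //.
by rewrite !(nth_map 0) ?nth_iota // !add0n E.
Qed.

Lemma graphs_not_isomorphic i j : i < 6 -> j < 6 -> i != j ->
  ~ isomorphic (lgraph 21 (graph i)) (lgraph 21 (graph j)).
Proof.
move=> lti ltj ij; apply: (not_isomorphic (graph_cubic lti) (graph_cubic ltj)
    (vs := vertex_order i)).
- by rewrite (perm_uniq (vertex_order_perm lti)) iota_uniq.
- by move=> v; rewrite (perm_mem (vertex_order_perm lti)) mem_iota.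
have none : all (fun a => all (fun b => (a != b) ==>
   (iso_maps 21 (graph a) (graph b) (vertex_order a) == [::])) (iota 0 6)) (iota 0 6).
  by vm_compute.
by have /implyP/(_ ij)/eqP := all_upto (all_upto none lti) ltj.
Qed.

Theorem theorem7p2 :
  exists G : 'I_6 -> sgraph,
    (forall i, [/\ graph_order (G i) = 22, cubic (G i) & is_connected (G i)]) /\
    (forall i j, i != j -> ~ isomorphic (G i) (G j)) /\
    (forall i j,
       graph_order (G i) = graph_order (G j) /\
       graph_size (G i) = graph_size (G j) /\
       girth (G i) = girth (G j) /\
       diameter (G i) = diameter (G j) /\
       radius (G i) = radius (G j) /\
       vertex_connectivity (G i) = vertex_connectivity (G j) /\
       edge_connectivity (G i) = edge_connectivity (G j) /\
       aut_order (G i) = aut_order (G j) /\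
       chromatic_number (G i) = chromatic_number (G j) /\
       chromatic_index (G i) = chromatic_index (G j) /\
       domination_number (G i) = domination_number (G j) /\
       independence_number (G i) = independence_number (G j) /\
       matching_number (G i) = matching_number (G j) /\
       clique_number (G i) = clique_number (G j) /\
       circumference (G i) = circumference (G j) /\
       min_genus (G i) = min_genus (G j) /\
       perm_eq (spectrum (adjacency_mx (G i))) (spectrum (adjacency_mx (G j))) /\
       perm_eq (spectrum (laplacian_mx (G i))) (spectrum (laplacian_mx (G j))) /\
       spanning_tree_count (G i) = spanning_tree_count (G j)) /\
    (forall i j, i != j -> genus_poly (G i) <> genus_poly (G j)).
Proof.
exists (fun i => lgraph 21 (graph i)); split=> [i|].
  by split; [exact: lgraph_order | exact/lgraph_cubic/graph_cubic | exact: graph_connected].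
split=> [i j ij|]; first exact: graphs_not_isomorphic.
split=> [i j|i j ij /genus_poly_inj E]; last first.
  by case/eqP: ij; apply/val_inj/E.
have [lti ltj] := (ltn_ord i, ltn_ord j).
have [adji lapi] := graph_spectra lti; have [adjj lapj] := graph_spectra ltj.
have same (f : sgraph -> nat) v :
    (forall k, k < 6 -> f (lgraph 21 (graph k)) = v) ->
    f (lgraph 21 (graph i)) = f (lgraph 21 (graph j)).
  by move=> fv; rewrite (fv _ lti) (fv _ ltj).
split; first by rewrite !lgraph_order.
split; first exact: same graph_edges.
split; first exact: same graph_girth.
split; first exact: same graph_diameter.
split; first exact: same graph_radius.
split; first exact: same graph_vertex_connectivity.
split; first exact: same graph_edge_connectivity.
split; first exact: same graph_aut_order.
split; first exact: same graph_chromatic_number.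
split; first exact: same graph_chromatic_index.
split; first exact: same graph_domination_number.
split; first exact: same graph_independence_number.
split; first exact: same graph_matching_number.
split; first exact: same graph_clique_number.
split; first exact: (same _ _ (fun k _ => graph_circumference k)).
split; first exact: same graph_min_genus.
split; first by rewrite adji adjj.
split; first by rewrite lapi lapj.
exact: same graph_spanning_trees.
Qed.
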